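(* Selective Coloring parameterized by the distance to cluster of the input graph is fixed-parameter tractable: there is an algorithm that, given an instance $(G,\mathcal{V},k)$, decides it in time $g(\mathrm{dc}(G))\cdot |V(G)|^{O(1)}$ for some computable function $g$.
   Context: Selective Coloring: given a graph $G$, a partition $\mathcal{V}$ of $V(G)$ into parts, and an integer $k$, decide whether there is a set $X\subseteq V(G)$ containing exactly one vertex of each part of $\mathcal{V}$ such that the induced subgraph $G[X]$ admits a proper $k$-coloring. A cluster graph is a graph each of whose connected components is a clique; the distance to cluster $\mathrm{dc}(G)$ is the minimum size of a set $U\subseteq V(G)$ such that $G-U$ is a cluster graph. *)

(* Defs.v *)
From mathcomp Require Import all_boot.
Set Implicit Arguments.
Unset Strict Implicit.
Unset Printing Implicit Defensive.

(** * Graphs *)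

Record sgraph := SGraph {
  vertex :> finType;
  edge : rel vertex;
  edge_sym : symmetric edge;
  edge_irr : irreflexive edge }.

Section InducedSubgraph.
Variables (G : sgraph) (A : {set G}).

Definition induced_edge : rel {x : G | x \in A} :=
  fun x y => edge (val x) (val y).

Fact induced_edge_sym : symmetric induced_edge.
Proof. by move=> x y; apply: edge_sym. Qed.

Fact induced_edge_irr : irreflexive induced_edge.
Proof. by move=> x; apply: edge_irr. Qed.

Definition induced : sgraph := SGraph induced_edge_sym induced_edge_irr.

End InducedSubgraph.

Definition is_cluster (G : sgraph) : bool :=
  [forall x : G, forall y : G,
     connect (@edge G) x y ==> (x != y) ==> edge x y].

(** The default [setT] is itself admissible, so this is a genuine minimum
    (see [dc_min]). *)
Definition dc (G : sgraph) : nat :=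
  #|[arg min_(U < [set: G] | is_cluster (induced (~: U))) #|U| ]|.

Lemma dc_min (G : sgraph) :
  (exists2 U : {set G}, is_cluster (induced (~: U)) & #|U| = dc G) /\
  (forall U : {set G}, is_cluster (induced (~: U)) -> dc G <= #|U|).
Proof.
rewrite /dc; case: arg_minnP => [|U clU minU]; last by split; first exists U.
by apply/forallP => -[x xP]; exfalso; move: xP; rewrite !inE.
Qed.

Definition proper_coloring (G : sgraph) (k : nat) (f : G -> 'I_k) : Prop :=
  forall x y : G, edge x y -> f x <> f y.

Definition colorable (G : sgraph) (k : nat) : Prop :=
  exists f : G -> 'I_k, proper_coloring f.

Definition selective_colorable (G : sgraph) (P : {set {set G}}) (k : nat) :
    Prop :=
  exists X : {set G},
    (forall A : {set G}, A \in P -> #|X :&: A| = 1) /\ colorable (induced X) k.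

(** * Machine model

    Algorithms are programs of a first-order, call-by-value functional language
    over binary trees (pure Lisp; cf. the language F in N. D. Jones,
    "Computability and Complexity from a Programming Perspective").  A program
    is a finite list of function bodies, which may call each other recursively;
    execution starts with function 0.  The running time is the number of
    expression nodes evaluated.  This cost measure is polynomially equivalent
    to Turing machine time: with cons cells represented by shared pointers every
    step takes constant time on a pointer machine or RAM, and a Turing machine
    step (tape = two lists) takes constantly many evaluation steps.  For this
    it is essential that no primitive inspects more than the root of a tree. *)

Inductive tree := Leaf | Node of tree & tree.

Definition left_subtree (v : tree) := if v is Node l _ then l else Leaf.
Definition right_subtree (v : tree) := if v is Node _ r then r else Leaf.

(** [EVar i] and [ELet] use de Bruijn indices; [ECall f a] runs the body of
    function number [f] in the environment consisting of the value of [a]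
    only; [EIf] branches on whether the condition is a [Node]. *)
Inductive expr :=
  | EVar of nat
  | ELeaf
  | ENode of expr & expr
  | ELeft of expr
  | ERight of expr
  | EIf of expr & expr & expr
  | ELet of expr & expr
  | ECall of nat & expr.

Definition program := seq expr.

Definition body (p : program) (f : nat) : expr := nth ELeaf p f.

(** [eval p s e v t]: in the environment [s], [e] terminates with value [v]
    after [t] steps. *)
Inductive eval (p : program) : seq tree -> expr -> tree -> nat -> Prop :=
  | eval_var s i : eval p s (EVar i) (nth Leaf s i) 1
  | eval_leaf s : eval p s ELeaf Leaf 1
  | eval_node s a b u v m n :
      eval p s a u m -> eval p s b v n ->
      eval p s (ENode a b) (Node u v) (m + n).+1
  | eval_left s a u m :
      eval p s a u m -> eval p s (ELeft a) (left_subtree u) m.+1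
  | eval_right s a u m :
      eval p s a u m -> eval p s (ERight a) (right_subtree u) m.+1
  | eval_if_node s c a b l r v m n :
      eval p s c (Node l r) m -> eval p s a v n ->
      eval p s (EIf c a b) v (m + n).+1
  | eval_if_leaf s c a b v m n :
      eval p s c Leaf m -> eval p s b v n ->
      eval p s (EIf c a b) v (m + n).+1
  | eval_let s a b u v m n :
      eval p s a u m -> eval p (u :: s) b v n ->
      eval p s (ELet a b) v (m + n).+1
  | eval_call s f a u v m n :
      eval p s a u m -> eval p [:: u] (body p f) v n ->
      eval p s (ECall f a) v (m + n).+1.

Definition runs (p : program) (input output : tree) (time : nat) : Prop :=
  eval p [:: input] (body p 0) output time.

Lemma eval_det (p : program) s e v t v' t' :
  eval p s e v t -> eval p s e v' t' -> v = v' /\ t = t'.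
Proof.
move=> ev; elim: ev v' t' => {s e v t};
intros; match goal with H : eval _ _ _ v' _ |- _ => inversion H; subst end;
repeat match goal with
  | IH : forall v t, eval p ?s ?e v t -> _, H : eval p ?s ?e _ _ |- _ =>
    destruct (IH _ _ H); clear H; subst; try discriminate
  end; split; congruence.
Qed.

(** * Encoding of inputs and outputs *)

Definition encode_bool (b : bool) : tree := if b then Node Leaf Leaf else Leaf.

Definition encode_nat (n : nat) : tree := iter n (Node Leaf) Leaf.

Definition encode_seq (T : Type) (enc : T -> tree) (s : seq T) : tree :=
  foldr (fun x => Node (enc x)) Leaf s.

(** Adjacency matrix, with vertices listed in the order of [enum G]. *)
Definition encode_graph (G : sgraph) : tree :=
  encode_seq (encode_seq encode_bool)
    [seq [seq edge x y | y <- enum G] | x <- enum G].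

(** Each part is given by its characteristic vector. *)
Definition encode_parts (G : sgraph) (P : {set {set G}}) : tree :=
  encode_seq (encode_seq encode_bool)
    [seq [seq x \in A | x <- enum G] | A : {set G} <- enum P].

(** Unary [k] is harmless: running times are measured against the number of
    vertices rather than against the length of this encoding. *)
Definition encode_instance (G : sgraph) (P : {set {set G}}) (k : nat) : tree :=
  Node (encode_graph G) (Node (encode_parts P) (encode_nat k)).

Definition computable (g : nat -> nat) : Prop :=
  exists p : program,
    forall n : nat, exists t : nat, runs p (encode_nat n) (encode_nat (g n)) t.

(* Main.v *)
Require Import Defs.
From mathcomp Require Import all_boot.
From mathcomp Require Import zify.
Set Implicit Arguments.
Unset Strict Implicit.
Unset Printing Implicit Defensive.

(** Colours are represented by vertices.  For D = 0, 1, 2, ... every induced P3 of G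
    is destroyed, in at most D steps, by branching on which of its three vertices to
    delete and on the role of that vertex: either it is not selected, or it is
    selected and receives one of D colours.  The smallest D for which this succeeds
    is dc(G); that D colours suffice for the deleted vertices follows by renaming
    colours.  It remains to extend such a partial selection to the cluster graph that
    is left.  In a proper colouring a colour occurs at most once in each clique, so
    this is the problem of matching the parts that are not hit yet into the slots
    (clique, colour).  It is solved by an auction: a part without a slot takes the
    cheapest slot it can use, evicts the part holding it, and raises its price by
    one; if a perfect matching exists, no price exceeds the number of parts, so that
    a polynomial number of rounds suffices.

    The program is obtained from a language of terminating loop programs, whose folds
    are truncated to a given amount of fuel L, so that their running time is
    automatically polynomial in L.  With fuel (|V| + 1)^4 + 2^2^(D+2) no truncation
    occurs in round D. *)

(** * Loop programs *)

(** Every expression denotes a total function of one tree [HEnv], relative to a fixed tree [HGlob]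
    that carries the fuel and the input. Variables are packed into nested pairs, and folds are the
    only form of repetition. *)
Inductive hexpr :=
  | HEnv
  | HGlob
  | HLeaf
  | HNode of hexpr & hexpr
  | HLeft of hexpr
  | HRight of hexpr
  | HIf of hexpr & hexpr & hexpr
  | HApp of hexpr & hexpr
  | HFold of hexpr & hexpr & hexpr.

Fixpoint spine (v : tree) : seq tree :=
  if v is Node x r then x :: spine r else [::].

Definition cap (gt : tree) : nat := size (spine (left_subtree gt)).

(** A fold makes at most [cap gt] iterations, whatever the list: this bounds the
    running time by [time_bound] independently of the data. *)
Fixpoint den (gt : tree) (h : hexpr) (E : tree) : tree :=
  match h with
  | HEnv => E
  | HGlob => gt
  | HLeaf => Leaf
  | HNode a b => Node (den gt a E) (den gt b E)
  | HLeft a => left_subtree (den gt a E)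
  | HRight a => right_subtree (den gt a E)
  | HIf c a b => if den gt c E is Node _ _ then den gt a E else den gt b E
  | HApp b a => den gt b (den gt a E)
  | HFold l a b =>
    foldl (fun acc x => den gt b (Node x (Node acc E))) (den gt a E)
          (take (cap gt) (spine (den gt l E)))
  end.

(** Only a fold needs a function of its own in the compiled program, so this is the size of the
    block of functions reserved for [h]. *)
Fixpoint folds (h : hexpr) : nat :=
  match h with
  | HEnv | HGlob | HLeaf => 0
  | HLeft a | HRight a => folds a
  | HNode a b | HApp b a => folds a + folds b
  | HIf a b c => folds a + (folds b + folds c)
  | HFold a b c => (folds a + (folds b + folds c)).+1
  end.

(** The argument of the function of index [i] is
    [Node list (Node cap (Node acc (Node gt E)))]. *)
Definition loop_body (i : nat) (b : expr) : expr :=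
  let l := ELeft (EVar 0) in
  let f := ELeft (ERight (EVar 0)) in
  let acc := ELeft (ERight (ERight (EVar 0))) in
  let ge := ERight (ERight (ERight (EVar 0))) in
  EIf l
    (EIf f
      (ECall i (ENode (ERight l) (ENode (ERight f) (ENode
         (ELet (ENode (ELeft ge) (ENode (ELeft l) (ENode acc (ERight ge)))) b)
         ge))))
      acc)
    acc.

(** The index [i] is the first free one; subexpressions use consecutive blocks. The code expects
    [Node gt E] in variable 0 and reads no other free variable, so it can be placed under an
    [ELet]. *)
Fixpoint code (i : nat) (h : hexpr) : expr :=
  match h with
  | HEnv => ERight (EVar 0)
  | HGlob => ELeft (EVar 0)
  | HLeaf => ELeaf
  | HNode a b => ENode (code i a) (code (i + folds a) b)
  | HLeft a => ELeft (code i a)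
  | HRight a => ERight (code i a)
  | HIf a b c => EIf (code i a) (code (i + folds a) b)
                     (code (i + folds a + folds b) c)
  | HApp b a => ELet (ENode (ELeft (EVar 0)) (code i a)) (code (i + folds a) b)
  | HFold l a b =>
    ECall i (ENode (code i.+1 l) (ENode (ELeft (ELeft (EVar 0)))
              (ENode (code (i.+1 + folds l) a) (EVar 0))))
  end.

Fixpoint functions (i : nat) (h : hexpr) : seq expr :=
  match h with
  | HEnv | HGlob | HLeaf => [::]
  | HLeft a | HRight a => functions i a
  | HNode a b | HApp b a => functions i a ++ functions (i + folds a) b
  | HIf a b c => functions i a ++ functions (i + folds a) b ++
                 functions (i + folds a + folds b) c
  | HFold l a b =>
    loop_body i (code (i.+1 + folds l + folds a) b) ::
    functions i.+1 l ++ functions (i.+1 + folds l) a ++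
    functions (i.+1 + folds l + folds a) b
  end.

Lemma size_functions i h : size (functions i h) = folds h.
Proof.
elim: h i => //= [a IHa b IHb|a IHa b IHb c IHc|b IHb a IHa|a IHa b IHb c IHc] i;
  by rewrite !size_cat ?IHa ?IHb ?IHc.
Qed.

Fixpoint time_bound (h : hexpr) (L : nat) : nat :=
  match h with
  | HEnv | HGlob => 2
  | HLeaf => 1
  | HLeft a | HRight a => (time_bound a L).+1
  | HNode a b => (time_bound a L + time_bound b L).+1
  | HIf a b c => (time_bound a L + (time_bound b L + time_bound c L)).+1
  | HApp b a => time_bound a L + time_bound b L + 4
  | HFold l a b =>
    time_bound l L + time_bound a L + 30 + L * (time_bound b L + 50)
  end.

(** * Values and running times of compiled loop programs *)

Definition hosts (p : program) (i : nat) (bs : seq expr) : Prop :=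
  forall j, j < size bs -> body p (i + j) = nth ELeaf bs j.

Lemma hosts_cat p i bs1 bs2 :
  hosts p i (bs1 ++ bs2) -> hosts p i bs1 /\ hosts p (i + size bs1) bs2.
Proof.
move=> H; split=> j lj.
  by rewrite H ?nth_cat ?lj // size_cat; lia.
rewrite -addnA H ?nth_cat ?size_cat; last by lia.
by rewrite ltnNge leq_addr /= addKn.
Qed.

Lemma hosts_cons p i b bs :
  hosts p i (b :: bs) -> body p i = b /\ hosts p i.+1 bs.
Proof.
move=> H; split; first by rewrite -(addn0 i) H.
by move=> j lj; rewrite addSnnS H.
Qed.

Definition eval_in (p : program) s e v t :=
  exists2 t', eval p s e v t' & t' <= t.

(** Expressions without branching, binding and calls are evaluated by computation, so that
    [eval_simple] settles all the packing and unpacking of argument tuples, with exact cost. *)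
Fixpoint simple_value (s : seq tree) (e : expr) : tree :=
  match e with
  | EVar i => nth Leaf s i
  | ENode a b => Node (simple_value s a) (simple_value s b)
  | ELeft a => left_subtree (simple_value s a)
  | ERight a => right_subtree (simple_value s a)
  | _ => Leaf
  end.

Fixpoint simple_time (e : expr) : nat :=
  match e with
  | ENode a b => (simple_time a + simple_time b).+1
  | ELeft a | ERight a => (simple_time a).+1
  | _ => 1
  end.

Fixpoint simple (e : expr) : bool :=
  match e with
  | EVar _ | ELeaf => true
  | ENode a b => simple a && simple b
  | ELeft a | ERight a => simple a
  | _ => false
  end.

Lemma eval_simple p s e v :
  simple e -> simple_value s e = v -> eval p s e v (simple_time e).
Proof.
move=> + <-; elim: e => //= [i|_|a IHa b IHb /andP[/IHa ? /IHb ?]|a IHa /IHa ?|a IHa /IHa ?];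
  by constructor.
Qed.

(** Induction on the fuel [f]. The body must run on top of a nonempty rest [s], because [loop_body]
    binds its argument by an [ELet]. The constants 20 and 50 cover the final test and the overhead
    of one iteration. *)
Lemma eval_loop p i gt E b (B : nat) (step : tree -> tree -> tree) :
  body p i = loop_body i b ->
  (forall x acc s, eval_in p (Node gt (Node x (Node acc E)) :: s) b
     (step acc x) B) ->
  forall f l acc,
  eval_in p [:: Node l (Node f (Node acc (Node gt E)))] (loop_body i b)
    (foldl step acc (take (size (spine f)) (spine l)))
    (20 + size (spine f) * (B + 50)).
Proof.
move=> bi Hb; elim=> [|f0 _ f IHf] [|x l] acc /=.
- by eexists; [apply: eval_if_leaf; exact: eval_simple|].
- eexists; first apply: eval_if_node; try exact: eval_simple.
    by apply: eval_if_leaf; exact: eval_simple.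
  by rewrite /=; lia.
- by eexists; [apply: eval_if_leaf; exact: eval_simple|].
have [tb Eb lb] := Hb x acc [:: Node (Node x l) (Node (Node f0 f) (Node acc (Node gt E)))].
have [tl El ll] := IHf l (step acc x).
eexists; first apply: eval_if_node; first exact: eval_simple.
  apply: eval_if_node; first exact: eval_simple.
  apply: eval_call; last by rewrite bi; apply: El.
  apply: eval_node; first exact: eval_simple.
  apply: eval_node; first exact: eval_simple.
  apply: eval_node; last exact: eval_simple.
  by apply: eval_let; last apply: Eb; exact: eval_simple.
by rewrite /=; lia.
Qed.

Lemma eval_code p gt h i : hosts p i (functions i h) -> forall E s,
  eval_in p (Node gt E :: s) (code i h) (den gt h E) (time_bound h (cap gt)).
Proof.
elim: h i => [|||a IHa b IHb|a IHa|a IHa|c IHc a IHa b IHb|b IHb a IHa|l IHl a IHa b IHb]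
  i /= H E s; move: H.
- by move=> _; exists 2 => //; exact: (eval_right (eval_var p _ 0)).
- by move=> _; exists 2 => //; exact: (eval_left (eval_var p _ 0)).
- by move=> _; exists 1 => //; constructor.
- case/hosts_cat; rewrite size_functions => /IHa /(_ E s) [ta Ea la].
  move=> /IHb /(_ E s) [tb Eb lb].
  by eexists; [apply: eval_node; [apply: Ea|apply: Eb]|lia].
- by move=> /IHa /(_ E s) [ta Ea la]; eexists; [apply: eval_left Ea|].
- by move=> /IHa /(_ E s) [ta Ea la]; eexists; [apply: eval_right Ea|].
- case/hosts_cat; rewrite size_functions => /IHc /(_ E s) [tc Ec lc].
  case/hosts_cat; rewrite size_functions => /IHa /(_ E s) [ta Ea la].
  move=> /IHb /(_ E s) [tb Eb lb].
  case: (den gt c E) Ec => [|u v] Ec.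
    by eexists; [apply: eval_if_leaf; [apply: Ec|apply: Eb]|lia].
  by eexists; [apply: eval_if_node; [apply: Ec|apply: Ea]|lia].
- case/hosts_cat; rewrite size_functions => /IHa /(_ E s) [ta Ea la].
  move=> /IHb /(_ (den gt a E)) H.
  have [tb Eb lb] := H (Node gt E :: s).
  have Ein := eval_node (eval_left (eval_var p (Node gt E :: s) 0)) Ea.
  by eexists; [apply: eval_let Ein Eb|lia].
- case/hosts_cons => bi.
  case/hosts_cat; rewrite size_functions => /IHl /(_ E s) [tl El ll].
  case/hosts_cat; rewrite size_functions => /IHa /(_ E s) [ta Ea la] Hb.
  have [tb Eb lb] := eval_loop bi (fun x acc => IHb _ Hb (Node x (Node acc E)))
    (left_subtree gt) (den gt l E) (den gt a E).
  have Ein := eval_node El (eval_node (eval_left (eval_left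
    (eval_var p (Node gt E :: s) 0))) (eval_node Ea (eval_var p (Node gt E :: s) 0))).
  rewrite -bi in Eb; eexists; first exact: eval_call Ein Eb.
  by rewrite -/(cap gt) in lb; lia.
Qed.

(** * Polynomial bounds *)

Definition poly_bounded (T : nat -> nat) : Prop :=
  exists K e, forall L, T L <= K * L.+1 ^ e.

Lemma poly_const c : poly_bounded (fun=> c).
Proof. by exists c, 0 => L; rewrite muln1. Qed.

Lemma poly_id : poly_bounded (fun L => L).
Proof. by exists 1, 1 => L; lia. Qed.

Lemma poly_add T1 T2 : poly_bounded T1 -> poly_bounded T2 ->
  poly_bounded (fun L => T1 L + T2 L).
Proof.
move=> [K1 [e1 H1]] [K2 [e2 H2]]; exists (K1 + K2), (e1 + e2) => L.
have := H1 L; have := H2 L.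
have p1 : L.+1 ^ e1 <= L.+1 ^ (e1 + e2) by rewrite leq_pexp2l // leq_addr.
have p2 : L.+1 ^ e2 <= L.+1 ^ (e1 + e2) by rewrite leq_pexp2l // leq_addl.
by move: p1 p2; set u := _ ^ (e1 + e2); nia.
Qed.

Lemma poly_mul T1 T2 : poly_bounded T1 -> poly_bounded T2 ->
  poly_bounded (fun L => T1 L * T2 L).
Proof.
move=> [K1 [e1 H1]] [K2 [e2 H2]]; exists (K1 * K2), (e1 + e2) => L.
by rewrite expnD mulnACA leq_mul.
Qed.

Lemma poly_le T1 T2 : (forall L, T1 L <= T2 L) -> poly_bounded T2 -> poly_bounded T1.
Proof. by move=> H [K [e H2]]; exists K, e => L; apply: leq_trans (H2 L). Qed.

Lemma poly_time_bound h : poly_bounded (time_bound h).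
Proof.
elim: h => /= [|||a IHa b IHb|a IHa|a IHa|c IHc a IHa b IHb|b IHb a IHa|l IHl a IHa b IHb];
  try exact: poly_const.
- by apply: poly_le (poly_add (poly_add IHa IHb) (poly_const 1)) => L; lia.
- by apply: poly_le (poly_add IHa (poly_const 1)) => L; lia.
- by apply: poly_le (poly_add IHa (poly_const 1)) => L; lia.
- by apply: poly_le (poly_add (poly_add IHa IHb) (poly_add IHc (poly_const 1))) => L; lia.
- by apply: poly_add (poly_add IHa IHb) (poly_const 4).
- apply: poly_add (poly_add (poly_add IHl IHa) (poly_const 30)) _.
  by apply: poly_mul poly_id (poly_add IHb (poly_const 50)).
Qed.

(** * The algorithm *)

Definition truncate T m (s : seq T) : seq T :=
  (foldl (fun a v => if a.1 is m'.+1 then (m', v :: a.2) else a) (m, [::]) s).2.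

(** A fold cannot stop early, so the last success is returned; any success would do. *)
Definition ffind T U (f : T -> option U) (s : seq T) : option U :=
  foldl (fun r x => if f x is Some y then Some y else r) None s.

(** [L] is the fuel. The truncations [take L] have no effect for large [L]; they are
    there because loop programs can only fold over such lists. *)
Section Algorithm.
Variables (G : sgraph) (P : {set {set G}}) (k D L : nat).

(** The reversed order is the one that consing during a pass over the adjacency matrix produces. *)
Definition verts : seq G := rev (enum G).

(** More than [#|G|] colours are never of use, so vertices suffice as names even if [k] is large. *)
Definition palette : seq G := truncate k verts.

Definition small : seq G := truncate D palette.

(** The deleted vertices: those paired with [Some a] are selected with colour [a],
    those paired with [None] are not selected. *)
Definition cand : Type := seq (G * option G).

Definition decided (c : cand) (v : G) : bool :=
  has (fun e => e.1 == v) (take L c).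

Definition p3_at (c : cand) (u v w : G) : bool :=
  ~~ decided c u && (~~ decided c v && (~~ decided c w &&
  (edge u v && (edge v w && (~~ (u == w) && ~~ edge u w))))).

Definition p3 (c : cand) : option (G * (G * G)) :=
  ffind (fun u => ffind (fun v => ffind (fun w =>
    if p3_at c u v w then Some (u, (v, w)) else None) verts) verts) verts.

(** A candidate without an induced P3 is passed on unchanged, so that the candidates finished early
    are still present after [D] rounds. *)
Definition branch (acc : seq cand) (c : cand) : seq cand :=
  if p3 c is Some t then
    foldl (fun acc y =>
      foldl (fun acc d => ((y, Some d) :: c) :: acc) (((y, None) :: c) :: acc) small)
      acc [:: t.1; t.2.1; t.2.2]
  else c :: acc.

Definition cands : seq cand :=
  iter D (fun cs => foldl (fun acc c => branch acc c) [::] (take L cs)) [:: [::]].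

Definition sel (c : cand) : seq (G * G) :=
  foldl (fun acc e => if e.2 is Some a then (e.1, a) :: acc else acc) [::] (take L c).

Definition clash (e f : G * G) : bool := edge e.1 f.1 && (e.2 == f.2).

Definition together (e f : G * G) : bool :=
  has (fun A : {set G} => (e.1 \in A) && (f.1 \in A)) (enum P).

Definition valid (c : cand) : bool :=
  all (fun e => all (fun f =>
    ((e.1 == f.1) && (e.2 == f.2)) || ~~ (clash e f || together e f))
    (take L (sel c))) (take L (sel c)).

Definition usable (c : cand) (e : G * G) : bool :=
  ~~ decided c e.1 && ~~ has (fun f => clash e f) (take L (sel c)).

(** This is equality of slots: among the undecided vertices of a candidate without an induced P3,
    equal or adjacent means lying in the same clique. A slot is represented by any of its pairs. *)
Definition conf (e f : G * G) : bool :=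
  (e.2 == f.2) && ((e.1 == f.1) || edge e.1 f.1).

Definition price (log : seq (G * G)) (e : G * G) : nat :=
  count (fun f => conf f e) (take L log).

Definition hit (s : seq (G * G)) (A : {set G}) : bool :=
  has (fun e => e.1 \in A) (take L s).

Definition pending (c : cand) (s : seq (G * G)) : option {set G} :=
  ffind (fun A : {set G} => if hit (sel c) A || hit s A then None else Some A) (enum P).

Definition cheaper (log : seq (G * G)) (r : option (G * G)) (e : G * G) : option (G * G) :=
  if r is Some f then if price log e < price log f then Some e else r else Some e.

Definition best (c : cand) (log : seq (G * G)) (A : {set G}) : option (G * G) :=
  foldl (fun r v => foldl (fun r a =>
    if (v \in A) && usable c (v, a) then cheaper log r (v, a) else r)
    r palette) None verts.

(** The first component of the state lists the slots that are held, the second all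
    bids made so far; each bid raises the price of its slot by one. *)
Definition bid (c : cand) (st : seq (G * G) * seq (G * G)) :=
  if pending c st.1 is Some A then
    if best c st.2 A is Some x then
      (x :: rev [seq e <- take L st.1 | ~~ conf x e], x :: st.2)
    else st
  else st.

Definition auction (c : cand) : seq (G * G) := (iter L (bid c) ([::], [::])).1.

Definition feasible (c : cand) : bool :=
  valid c && all (fun A : {set G} => hit (sel c) A || hit (auction c) A) (enum P).

(** [None] reports that no candidate got rid of all induced P3s; with enough fuel this happens only
    for [D] below [dc G]. *)
Definition result : option bool :=
  foldl (fun r c => if p3 c is Some t then r
    else Some (feasible c || (if r is Some b then b else false))) None (take L cands).

Lemma truncateE T m (s : seq T) : truncate m s = rev (take m s).
Proof.
rewrite /truncate; set F := (fun a v => _).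
suff H : forall acc, (foldl F (m, acc) s).2 = rev (take m s) ++ acc by rewrite H cats0.
elim: s m => [|x s IH] [|m] acc //=; first by rewrite (IH 0) take0.
by rewrite IH rev_cons cat_rcons.
Qed.

Lemma size_truncate T m (s : seq T) : size (truncate m s) = minn m (size s).
Proof. by rewrite truncateE size_rev size_take_min. Qed.

End Algorithm.

(** * Realizability by loop programs *)

Class encodable (A : Type) := enc : A -> tree.

#[local] Instance enc_unit : encodable unit := fun=> Leaf.
#[local] Instance enc_bool : encodable bool := encode_bool.
#[local] Instance enc_nat : encodable nat := encode_nat.
#[local] Instance enc_seq A `{encodable A} : encodable (seq A) := encode_seq enc.
#[local] Instance enc_pair A B `{encodable A} `{encodable B} : encodable (A * B) :=
  fun x => Node (enc x.1) (enc x.2).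
#[local] Instance enc_option A `{encodable A} : encodable (option A) :=
  fun o => if o is Some x then Node (enc x) Leaf else Leaf.
(** Positions in [enum G] turn adjacency and membership into lookups in the rows of the input. *)
#[local] Instance enc_vertex (G : sgraph) : encodable G :=
  fun v => encode_nat (index v (enum G)).
#[local] Instance enc_set (G : sgraph) : encodable {set G} :=
  fun A => encode_seq encode_bool [seq x \in A | x <- enum G].

Lemma spine_encode_seq A (e : A -> tree) s : spine (encode_seq e s) = map e s.
Proof. by elim: s => //= x s ->. Qed.

Lemma spine_encode_nat n : spine (encode_nat n) = nseq n Leaf.
Proof. by elim: n => //= n ->. Qed.

Lemma encode_seq_map A B (e : B -> tree) (f : A -> B) s :
  encode_seq e (map f s) = encode_seq (e \o f) s.
Proof. by elim: s => //= x s ->. Qed.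

Lemma foldl_nseq A B (f : A -> A) (a : A) n (t : B) :
  foldl (fun acc _ => f acc) a (nseq n t) = iter n f a.
Proof. by elim: n a => //= n IH a; rewrite IH -iterSr. Qed.

Definition globals (G : sgraph) (P : {set {set G}}) (k D L : nat) : tree :=
  Node (encode_nat L) (Node (encode_nat D) (encode_instance P k)).

Section Realizers.
Variables (G : sgraph) (P : {set {set G}}) (k D L : nat).
Hypotheses (GL : #|G| <= L) (PL : #|P| <= L) (DL : D <= L) (L3 : 3 <= L).

Notation gt := (globals P k D L).

(** [X] is the type of the tuple of variables in scope. Each lemma below compiles one construct,
    extending [X] where it binds variables. *)
Definition realizes {X A} `{encodable X} `{encodable A} (h : hexpr) (f : X -> A) :=
  forall x, den gt h (enc x) = enc (f x).

Context {X : Type} {eX : encodable X}.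

Lemma cap_globals : cap gt = L.
Proof. by rewrite /cap /= spine_encode_nat size_nseq. Qed.

Lemma rz_ext A `{encodable A} h (f g : X -> A) :
  f =1 g -> realizes h f -> realizes h g.
Proof. by move=> fg Hf x; rewrite Hf fg. Qed.

Lemma rz_id : realizes HEnv (fun x : X => x).
Proof. by []. Qed.

Lemma rz_fst A B `{encodable A} `{encodable B} h (f : X -> A * B) :
  realizes h f -> realizes (HLeft h) (fun x => (f x).1).
Proof. by move=> Hf x /=; rewrite Hf. Qed.

Lemma rz_snd A B `{encodable A} `{encodable B} h (f : X -> A * B) :
  realizes h f -> realizes (HRight h) (fun x => (f x).2).
Proof. by move=> Hf x /=; rewrite Hf. Qed.

Lemma rz_pair A B `{encodable A} `{encodable B} h1 h2 (f : X -> A) (g : X -> B) :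
  realizes h1 f -> realizes h2 g -> realizes (HNode h1 h2) (fun x => (f x, g x)).
Proof. by move=> Hf Hg x /=; rewrite Hf Hg. Qed.

Lemma rz_nil A `{encodable A} : realizes HLeaf (fun _ : X => [::] : seq A).
Proof. by []. Qed.

Lemma rz_cons A `{encodable A} h1 h2 (f : X -> A) g :
  realizes h1 f -> realizes h2 g -> realizes (HNode h1 h2) (fun x => f x :: g x).
Proof. by move=> Hf Hg x /=; rewrite Hf Hg. Qed.

Lemma rz_none A `{encodable A} : realizes HLeaf (fun _ : X => None : option A).
Proof. by []. Qed.

Lemma rz_some A `{encodable A} h (f : X -> A) :
  realizes h f -> realizes (HNode h HLeaf) (fun x => Some (f x)).
Proof. by move=> Hf x /=; rewrite Hf. Qed.

Lemma rz_false : realizes HLeaf (fun _ : X => false).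
Proof. by []. Qed.

Lemma rz_true : realizes (HNode HLeaf HLeaf) (fun _ : X => true).
Proof. by []. Qed.

Lemma rz_if A `{encodable A} h1 h2 h3 p (f g : X -> A) :
  realizes h1 p -> realizes h2 f -> realizes h3 g ->
  realizes (HIf h1 h2 h3) (fun x => if p x then f x else g x).
Proof. by move=> Hp Hf Hg x /=; rewrite Hp Hf Hg; case: (p x). Qed.

Lemma rz_neg h p : realizes h p ->
  realizes (HIf h HLeaf (HNode HLeaf HLeaf)) (fun x : X => ~~ p x).
Proof. by move=> Hp x /=; rewrite Hp; case: (p x). Qed.

Lemma rz_and h1 h2 (p q : X -> bool) : realizes h1 p -> realizes h2 q ->
  realizes (HIf h1 h2 HLeaf) (fun x => p x && q x).
Proof. by move=> Hp Hq x /=; rewrite Hp Hq; case: (p x). Qed.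

Lemma rz_or h1 h2 (p q : X -> bool) : realizes h1 p -> realizes h2 q ->
  realizes (HIf h1 (HNode HLeaf HLeaf) h2) (fun x => p x || q x).
Proof. by move=> Hp Hq x /=; rewrite Hp Hq; case: (p x). Qed.

Lemma rz_option A B `{encodable A} `{encodable B} h1 h2 h3
    (o : X -> option A) (f : X -> A -> B) (g : X -> B) :
  realizes h1 o -> realizes h2 (fun e : A * X => f e.2 e.1) -> realizes h3 g ->
  realizes (HIf h1 (HApp h2 (HNode (HLeft h1) HEnv)) h3)
    (fun x => if o x is Some y then f x y else g x).
Proof.
move=> Ho Hf Hg x /=; rewrite Ho; case: (o x) => [y|] /=; last by rewrite Hg.
exact: (Hf (y, x)).
Qed.

Lemma rz_zero : realizes HLeaf (fun _ : X => 0).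
Proof. by []. Qed.

Lemma rz_succ h (n : X -> nat) :
  realizes h n -> realizes (HNode HLeaf h) (fun x => (n x).+1).
Proof. by move=> Hn x /=; rewrite Hn. Qed.

Lemma rz_nat_case B `{encodable B} h1 h2 h3
    (n : X -> nat) (f : X -> nat -> B) (g : X -> B) :
  realizes h1 n -> realizes h2 (fun e : nat * X => f e.2 e.1) -> realizes h3 g ->
  realizes (HIf h1 (HApp h2 (HNode (HRight h1) HEnv)) h3)
    (fun x => if n x is m.+1 then f x m else g x).
Proof.
move=> Hn Hf Hg x /=; rewrite Hn; case: (n x) => [|m] /=; first by rewrite Hg.
exact: (Hf (m, x)).
Qed.

Lemma rz_foldl_take A B `{encodable A} `{encodable B} h1 h2 h3
    (l : X -> seq B) (a : X -> A) (f : X -> A -> B -> A) :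
  realizes h1 l -> realizes h2 a ->
  realizes h3 (fun e : B * (A * X) => f e.2.2 e.2.1 e.1) ->
  realizes (HFold h1 h2 h3)
    (fun x => foldl (fun acc y => f x acc y) (a x) (take L (l x))).
Proof.
move=> Hl Ha Hf x; rewrite /= cap_globals Hl Ha spine_encode_seq -map_take.
elim: (take L (l x)) (a x) => //= y s IH acc.
by rewrite (Hf (y, (acc, x))) IH.
Qed.

Lemma rz_foldl A B `{encodable A} `{encodable B} h1 h2 h3
    (l : X -> seq B) (a : X -> A) (f : X -> A -> B -> A) :
  (forall x, size (l x) <= L) ->
  realizes h1 l -> realizes h2 a ->
  realizes h3 (fun e : B * (A * X) => f e.2.2 e.2.1 e.1) ->
  realizes (HFold h1 h2 h3) (fun x => foldl (fun acc y => f x acc y) (a x) (l x)).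
Proof.
move=> ll Hl Ha Hf; apply: rz_ext (rz_foldl_take Hl Ha Hf) => x.
by rewrite take_oversize.
Qed.

Lemma rz_iter A `{encodable A} h1 h2 h3
    (n : X -> nat) (f : X -> A -> A) (a : X -> A) :
  (forall x, n x <= L) ->
  realizes h1 n -> realizes h2 a -> realizes h3 (fun e : A * X => f e.2 e.1) ->
  realizes (HFold h1 h2 (HApp h3 (HRight HEnv))) (fun x => iter (n x) (f x) (a x)).
Proof.
move=> nl Hn Ha Hf x; rewrite /= cap_globals Hn Ha spine_encode_nat.
rewrite take_oversize ?size_nseq // -(foldl_nseq _ _ _ Leaf).
by elim: (n x) (a x) => //= m IH acc; rewrite (Hf (acc, x)) IH.
Qed.

Lemma rz_fuel : realizes (HLeft HGlob) (fun _ : X => L).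
Proof. by []. Qed.

Lemma rz_depth : realizes (HLeft (HRight HGlob)) (fun _ : X => D).
Proof. by []. Qed.

Lemma rz_colors : realizes (HRight (HRight (HRight (HRight HGlob)))) (fun _ : X => k).
Proof. by []. Qed.

Lemma rz_parts : realizes (HLeft (HRight (HRight (HRight HGlob)))) (fun _ : X => enum P).
Proof. by move=> x; rewrite /= /encode_parts encode_seq_map. Qed.

(** The iterated predecessor is the truncated difference [b - a], whose unary code is a [Node]
    exactly when it is positive. *)
Lemma rz_ltn h (a b : X -> nat) :
  realizes h (fun x => iter (a x) predn (b x)) ->
  realizes (HIf h (HNode HLeaf HLeaf) HLeaf) (fun x => a x < b x).
Proof.
move=> H x; rewrite /= H -subn_gt0.
have -> : iter (a x) predn (b x) = b x - a x.
  by elim: (a x) => [|m IH] /=; rewrite ?subn0 // IH subnS.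
by case: (b x - a x).
Qed.

Lemma rz_predn h (a : X -> nat) :
  realizes h a -> realizes (HRight h) (fun x => (a x).-1).
Proof. by move=> Ha x; rewrite /= Ha; case: (a x). Qed.

Lemma foldl_cons A (s acc : seq A) : foldl (fun acc y => y :: acc) acc s = catrev s acc.
Proof. by elim: s acc => //= y s IH acc; rewrite IH. Qed.

Definition h_cons := HNode (HLeft HEnv) (HLeft (HRight HEnv)).

(** The inner fold truncates the list but reverses it; the outer one restores the order. *)
Lemma rz_take A `{encodable A} h (l : X -> seq A) : realizes h l ->
  realizes (HFold (HFold h HLeaf h_cons) HLeaf h_cons) (fun x => take L (l x)).
Proof.
move=> Hl.
have Hc : realizes h_cons (fun e : A * (seq A * X) => e.1 :: e.2.1) by [].
have H1 := rz_foldl_take (f := fun _ acc y => y :: acc) Hl (@rz_nil A _) Hc.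
apply: (rz_ext _ (rz_foldl (f := fun _ acc y => y :: acc) _ H1 (@rz_nil A _) Hc)) => x /=.
  by rewrite !foldl_cons !catrevE !cats0 revK.
by rewrite foldl_cons catrevE cats0 size_rev size_take_min geq_minl.
Qed.

(** Both projections of [Leaf] are [Leaf], so walking past the end yields [Leaf], which therefore
    has to be the code of the default. *)
Lemma rz_nth A `{encodable A} d h1 h2 (l : X -> seq A) (i : X -> nat) :
  enc d = Leaf -> (forall x, i x <= L) -> realizes h1 l -> realizes h2 i ->
  realizes (HLeft (HFold h2 h1 (HRight (HLeft (HRight HEnv)))))
    (fun x => nth d (l x) (i x)).
Proof.
move=> ed il Hl Hi x; rewrite /= cap_globals Hl Hi spine_encode_nat.
rewrite take_oversize ?size_nseq // foldl_nseq.
have E m (s : seq A) : iter m right_subtree (enc s) = enc (drop m s).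
  elim: m => [|m IH] /=; first by rewrite drop0.
  by rewrite IH -add1n -drop_drop; case: (drop m s) => [|y t] //=; rewrite drop0.
by rewrite E -[in RHS](addn0 (i x)) -nth_drop; case: (drop _ _) => //=; rewrite ed.
Qed.

Lemma rz_has A h (p : X -> A -> bool) (l : X -> seq A) :
  realizes h (fun x => foldl (fun b y => if p x y then true else b) false (l x)) ->
  realizes h (fun x => has (p x) (l x)).
Proof.
apply: rz_ext => x; rewrite -[RHS]orFb; move: false.
elim: (l x) => [|y s IH] b /=; first by rewrite orbF.
by rewrite IH; case: (p x y); rewrite ?orbT.
Qed.

Lemma rz_all A h (p : X -> A -> bool) (l : X -> seq A) :
  realizes h (fun x => foldl (fun b y => if p x y then b else false) true (l x)) ->
  realizes h (fun x => all (p x) (l x)).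
Proof.
apply: rz_ext => x; rewrite -[RHS]andTb; move: true.
elim: (l x) => [|y s IH] b /=; first by rewrite andbT.
by rewrite IH; case: (p x y); rewrite ?andbF.
Qed.

Lemma rz_count A h (p : X -> A -> bool) (l : X -> seq A) :
  realizes h (fun x => foldl (fun n y => if p x y then n.+1 else n) 0 (l x)) ->
  realizes h (fun x => count (p x) (l x)).
Proof.
apply: rz_ext => x; rewrite -[RHS]add0n; move: 0.
elim: (l x) => [|y s IH] b /=; first by rewrite addn0.
by rewrite IH; case: (p x y); rewrite ?addnA ?addn1 ?addn0.
Qed.

Lemma rz_rev_filter A `{encodable A} h (p : X -> A -> bool) (l : X -> seq A) :
  realizes h (fun x => foldl (fun acc y => if p x y then y :: acc else acc) [::] (l x)) ->
  realizes h (fun x => rev [seq y <- l x | p x y]).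
Proof.
apply: rz_ext => x; rewrite -[RHS]cats0; move: [::].
elim: (l x) => [|y s IH] acc //=; rewrite IH; case: (p x y) => //.
by rewrite rev_cons cat_rcons.
Qed.

Lemma rz_index h (v : X -> G) :
  realizes h v -> realizes h (fun x => index (v x) (enum G)).
Proof. by []. Qed.

(** The machine has no equality test on trees; two comparisons of indices replace it. *)
Lemma rz_eq h (u v : X -> G) :
  realizes h (fun x => ~~ (index (u x) (enum G) < index (v x) (enum G)) &&
                       ~~ (index (v x) (enum G) < index (u x) (enum G))) ->
  realizes h (fun x => u x == v x).
Proof.
apply: rz_ext => x; rewrite -!leqNgt andbC -eqn_leq; apply/eqP/eqP => [e|-> //].
by rewrite -(nth_index (u x) (mem_enum G (u x))) e nth_index ?mem_enum.
Qed.

Definition matrix : seq (seq bool) := [seq [seq edge x y | y <- enum G] | x <- enum G].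

Lemma rz_matrix : realizes (HLeft (HRight (HRight HGlob))) (fun _ : X => matrix).
Proof. by []. Qed.

Lemma index_enum_lt (v : G) : index v (enum G) < size (enum G).
Proof. by rewrite index_mem mem_enum. Qed.

Lemma rz_edge h (u v : X -> G) :
  realizes h (fun x => nth false (nth [::] matrix (index (u x) (enum G)))
                                 (index (v x) (enum G))) ->
  realizes h (fun x => edge (u x) (v x)).
Proof.
apply: rz_ext => x; rewrite (nth_map (u x)) ?index_enum_lt //.
by rewrite (nth_map (v x)) ?index_enum_lt // !nth_index ?mem_enum.
Qed.

Lemma rz_characteristic h (A : X -> {set G}) :
  realizes h A -> realizes h (fun x => [seq y \in A x | y <- enum G]).
Proof. by move=> HA x; rewrite HA /enc /enc_set /enc_seq. Qed.

Lemma rz_in h (A : X -> {set G}) (v : X -> G) :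
  realizes h (fun x => nth false [seq y \in A x | y <- enum G] (index (v x) (enum G))) ->
  realizes h (fun x => v x \in A x).
Proof.
by apply: rz_ext => x; rewrite (nth_map (v x)) ?index_enum_lt // nth_index ?mem_enum.
Qed.

(** The input does not list the vertices; counting the rows of the matrix yields their codes. The
    hypothesis is about numbers because a vertex and its index have the same code. *)
Lemma rz_verts h :
  realizes h (fun _ : X =>
    (foldl (fun a (_ : seq bool) => (a.1.+1, a.1 :: a.2)) (0, [::]) matrix).2 : seq nat) ->
  realizes h (fun _ : X => verts G).
Proof.
move=> H x; rewrite H /verts.
have E (s : seq (seq bool)) m acc :
    (foldl (fun a (_ : seq bool) => (a.1.+1, a.1 :: a.2)) (m, acc) s).2 =
    rev (iota m (size s)) ++ acc.
  by elim: s m acc => //= _ s IH m acc; rewrite IH rev_cons cat_rcons.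
rewrite E cats0 size_map /enc /enc_seq.
have -> : iota 0 (size (enum G)) = [seq index v (enum G) | v <- enum G].
  case: (enum G) (enum_uniq G) => // v0 s us.
  apply: (@eq_from_nth _ 0); rewrite ?size_iota ?size_map // => i li.
  by rewrite nth_iota // (nth_map v0) // index_uniq.
by rewrite -map_rev encode_seq_map.
Qed.

Lemma index_le (v : X -> G) x : index (v x) (enum G) <= L.
Proof. by apply: leq_trans GL; rewrite cardE ltnW // index_enum_lt. Qed.

Lemma size_verts_le (x : X) : size (verts G) <= L.
Proof. by rewrite size_rev -cardE. Qed.

Lemma size_palette_le (x : X) : size (palette G k) <= L.
Proof. by rewrite size_truncate geq_min size_verts_le ?orbT. Qed.

Lemma size_small_le (x : X) : size (small G k D) <= L.
Proof. by rewrite size_truncate geq_min size_palette_le ?orbT. Qed.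

Lemma size_parts_le (x : X) : size (enum P) <= L.
Proof. by rewrite -cardE. Qed.

Lemma size_matrix_le (x : X) : size matrix <= L.
Proof. by rewrite size_map -cardE. Qed.

Lemma size_take_le A (l : X -> seq A) x : size (take L (l x)) <= L.
Proof. by rewrite size_take_min geq_minl. Qed.

Lemma count_take_le A (p : X -> A -> bool) (l : X -> seq A) x :
  count (p x) (take L (l x)) <= L.
Proof. exact: leq_trans (count_size _ _) (size_take_le _ _). Qed.

End Realizers.

Ltac bound_size := solve
  [ exact: size_take_le | exact: count_take_le | exact: index_le | exact: size_verts_le
  | exact: size_palette_le | exact: size_small_le | exact: size_parts_le
  | exact: size_matrix_le | done ].

(** The head symbol of the function to be realized selects the lemma; goals of any other form are
    size bounds or assumptions. *)
Ltac realize_step := cbv beta; lazymatch goal with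
  | |- @realizes _ _ _ _ _ _ _ _ _ _ ?f => lazymatch f with
    | (fun x => x) => eapply rz_id
    | fst => eapply (rz_fst (f := fun x => x)); eapply rz_id
    | snd => eapply (rz_snd (f := fun x => x)); eapply rz_id
    | (fun x => fst _) => eapply rz_fst
    | (fun x => snd _) => eapply rz_snd
    | (fun x => pair _ _) => eapply rz_pair
    | (fun x => nil) => eapply rz_nil
    | (fun x => cons _ _) => eapply rz_cons
    | (fun x => None) => eapply rz_none
    | (fun x => Some _) => eapply rz_some
    | (fun x => true) => eapply rz_true
    | (fun x => false) => eapply rz_false
    | (fun x => negb _) => eapply rz_neg
    | (fun x => andb _ _) => eapply rz_and
    | (fun x => orb _ _) => eapply rz_or
    | (fun x => 0) => eapply rz_zero
    | (fun x => predn _) => eapply rz_predn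
    | (fun x => S _) => eapply rz_succ
    | (fun x => leq (S _) _) => eapply rz_ltn
    | (fun x => iter _ _ _) => eapply rz_iter
    | (fun x => foldl _ _ _) => eapply rz_foldl
    | (fun x => has _ _) => eapply rz_has
    | (fun x => all _ _) => eapply rz_all
    | (fun x => count _ _) => eapply rz_count
    | (fun x => rev (filter _ _)) => eapply rz_rev_filter
    | (fun x => take _ _) => eapply rz_take
    | (fun x => nth _ _ _) => eapply rz_nth
    | (fun x => index _ _) => eapply rz_index
    | (fun x => map _ (enum _)) => eapply rz_characteristic
    | (fun x => matrix _) => eapply rz_matrix
    | (fun x => verts _) => eapply rz_verts
    | (fun x => enum (pred_of_set _)) => eapply rz_parts
    | (fun x => edge _ _) => eapply rz_edge
    | (fun x => eq_op _ _) => eapply rz_eq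
    | (fun x => in_mem _ _) => eapply rz_in
    | (fun x => match _ with _ => _ end) =>
        first [eapply rz_if | eapply rz_option | eapply rz_nat_case]
    | _ => first [eapply rz_fuel | eapply rz_depth | eapply rz_colors]
    end
  | |- _ => first [eassumption | bound_size]
  end.

Ltac realize := cbv beta delta
  [result feasible auction bid best cheaper pending hit price conf usable valid
   together clash sel cands branch p3 p3_at decided small palette ffind truncate];
  repeat realize_step.

(** The loop program is synthesized by unification. *)
Lemma result_realized : exists h : hexpr,
  forall (G : sgraph) (P : {set {set G}}) (k D L : nat),
  #|G| <= L -> #|P| <= L -> D <= L -> 3 <= L ->
  @realizes G P k D L unit _ _ _ h (fun _ : unit => result P k D L).
Proof.
eexists => G P k D L GL PL DL L3.
by realize.
Qed.

(** * The auction *)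

Section Auction.
(** [Q] is the set of parts to be matched, [opt A e] says that [A] may bid for [e], and [m] is a
    perfect matching supposed to exist. Transitivity of [conf] is asked for options only, since it
    fails for arbitrary vertices of the graph. *)
Variables (I T : finType) (Q : {set I}) (opt : I -> pred T) (conf : rel T) (m : I -> T).

Definition is_option (e : T) : Prop := exists2 A, A \in Q & opt A e.

Hypothesis confxx : reflexive conf.
Hypothesis confC : symmetric conf.
Hypothesis conf_trans : forall e f g,
  is_option e -> is_option f -> is_option g -> conf e f -> conf f g -> conf e g.
Hypothesis opt_inj : forall A B e,
  A \in Q -> B \in Q -> opt A e -> opt B e -> A = B.
Hypothesis m_opt : forall A, A \in Q -> opt A (m A).
Hypothesis m_inj : forall A B, A \in Q -> B \in Q -> conf (m A) (m B) -> A = B.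

Definition cost (log : seq T) (e : T) : nat := count (fun f => conf f e) log.

(** [inv_slack] is approximate complementary slackness with the bid increment 1. [inv_held]
    expresses that a slot, once bid for, always has a holder. *)
Record auction_inv (S log : seq T) : Prop := AuctionInv {
  inv_opt : forall e, e \in S -> is_option e;
  inv_uniq : forall A e f, A \in Q -> e \in S -> f \in S ->
    opt A e -> opt A f -> e = f;
  inv_slack : forall A e f, A \in Q -> e \in S ->
    opt A e -> opt A f -> cost log e <= (cost log f).+1;
  inv_held : forall f, is_option f -> 0 < cost log f ->
    exists2 e, e \in S & conf e f;
  inv_log : forall e, e \in log -> is_option e;
  inv_cost : forall e, is_option e -> cost log e <= #|Q| }.

Lemma auction_inv_nil : auction_inv [::] [::].
Proof. by split. Qed.

Lemma cost_conf log e f :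
  (forall g, g \in log -> is_option g) -> is_option e -> is_option f ->
  conf e f -> cost log e = cost log f.
Proof.
move=> ol oe of_ ef; apply: eq_in_count => g /ol og.
by apply/idP/idP => H; [apply: conf_trans H ef|apply: conf_trans H _; rewrite // confC].
Qed.

(** If [x] cost at least [#|Q|], the parts holding an option of cost at least
    [t] (together with [A]) would, as [t] decreases, grow by at least one in each
    step: by [inv_slack] their partners under [m] cost at least [t - 1], hence are
    held, by pairwise distinct parts different from [A]. *)
Lemma cost_lt S log A x :
  auction_inv S log -> A \in Q -> (forall e, e \in S -> ~~ opt A e) ->
  (forall y, opt A y -> cost log x <= cost log y) ->
  cost log x < #|Q|.
Proof.
move=> [iopt iuniq islack iheld ilog _] AQ noA xmin.
pose lev t := [set B in Q | (B == A) ||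
  [exists e, [&& e \in S, opt B e & t <= cost log e]]].
have Alev t : A \in lev t by rewrite inE AQ eqxx.
have step t : 0 < t -> t <= cost log x -> #|lev t.+1| < #|lev t|.
  move=> t0 tx; rewrite [X in _ < X](cardsD1 A) Alev add1n ltnS.
  (* [r B] is a part holding the slot of [m B]. It lies in [lev t], differs from [A], and [r] is
     injective on [lev t.+1]. *)
  pose holds B C := [exists z, [&& z \in S, conf z (m B) & opt C z]].
  pose r B := odflt B [pick C in Q | holds B C].
  have rP B : B \in lev t.+1 -> [/\ B \in Q, r B \in Q &
      exists z, [/\ z \in S, conf z (m B), opt (r B) z & t <= cost log z]].
    rewrite inE => /andP[BQ HB].
    have mB : is_option (m B) by exists B => //; apply: m_opt.
    have tB : t <= cost log (m B).
      case/orP: HB => [/eqP BA|/existsP[e /and3P[eS eB te]]].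
        by rewrite BA; apply: leq_trans tx _; apply: xmin; apply: m_opt.
      by rewrite -ltnS; apply: leq_trans te (islack _ _ _ BQ eS eB (m_opt BQ)).
    have [z zS zB] := iheld _ mB (leq_trans t0 tB).
    have [C CQ Cz] := iopt _ zS.
    rewrite /r; case: pickP => [C' /andP[C'Q /existsP[z' /and3P[z'S z'B C'z']]]|/(_ C)].
      split=> //=; exists z'; split => //.
      by rewrite (cost_conf ilog _ mB z'B) //; exists C'.
    by rewrite CQ => /existsP[]; exists z; rewrite zS zB Cz.
  have rinj : {in lev t.+1 &, injective r}.
    move=> B C /rP[BQ rBQ [z [zS zB rz _]]] /rP[CQ rCQ [z' [z'S z'C rz' _]]] rBC.
    rewrite -rBC in rz'; have zz' := iuniq _ _ _ rBQ zS z'S rz rz'; subst z'.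
    apply: m_inj => //; have mo D : D \in Q -> is_option (m D).
      by move=> DQ; exists D => //; apply: m_opt.
    by apply: conf_trans _ z'C; rewrite ?(confC _ z) //; auto.
  rewrite -(card_in_imset rinj); apply/subset_leq_card/subsetP => _ /imsetP[B /rP[BQ rBQ [z [zS zB rz tz]]] ->].
  rewrite !inE rBQ; apply/andP; split.
    by apply: contraTneq rz => ->; apply: noA.
  by apply/orP; right; apply/existsP; exists z; rewrite zS rz.
(* Summing up [step] down to level 1: as the top level contains [A], [lev 1] has more than
   [cost log x] elements. *)
have H j : j <= cost log x -> #|lev (cost log x).+1| + j <= #|lev (cost log x - j).+1|.
  elim: j => [|j IH] lj; first by rewrite addn0 subn0.
  rewrite addnS; apply: leq_ltn_trans (IH (ltnW lj)) _.
  by rewrite subnS prednK ?subn_gt0 //; apply: step; rewrite ?subn_gt0 // leq_subr.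
have := H _ (leqnn _); rewrite subnn => H1.
have le1 : #|lev 1| <= #|Q| by apply/subset_leq_card/subsetP => B; rewrite inE => /andP[].
apply: leq_trans le1; apply: leq_trans H1; rewrite -add1n leq_add2r.
by apply/card_gt0P; exists A.
Qed.

Lemma cost_cons log x e : cost (x :: log) e = conf x e + cost log e.
Proof. by []. Qed.

(** The raised price stays within [#|Q|] by [cost_lt]. Slack holds for [A] because [x] was cheapest,
    and for the other remaining holders because their own prices are unchanged while no price
    falls. *)
Lemma auction_step S log A x :
  auction_inv S log -> A \in Q -> (forall e, e \in S -> ~~ opt A e) ->
  opt A x -> (forall y, opt A y -> cost log x <= cost log y) ->
  auction_inv (x :: rev [seq e <- S | ~~ conf x e]) (x :: log).
Proof.
move=> inv AQ noA xA xmin; have ltx := cost_lt inv AQ noA xmin.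
case: inv => iopt iuniq islack iheld ilog icost.
have ox : is_option x by exists A.
split.
- move=> e; rewrite inE mem_rev mem_filter => /predU1P[-> //|/andP[_]]; exact: iopt.
- move=> B e f BQ; rewrite !inE !mem_rev !mem_filter.
  move=> /predU1P[->|/andP[_ eS]] /predU1P[->|/andP[_ fS]] // eB fB.
  + by have := noA _ fS; rewrite (opt_inj AQ BQ xA eB) fB.
  + by have := noA _ eS; rewrite (opt_inj AQ BQ xA fB) eB.
  + exact: iuniq eB fB.
- move=> B e f BQ; rewrite inE mem_rev mem_filter => /predU1P[->|/andP[xe eS]] eB fB.
    rewrite !cost_cons confxx add1n ltnS.
    apply: leq_trans (leq_addl _ _); apply: xmin.
    by rewrite (opt_inj AQ BQ xA eB).
  rewrite !cost_cons (negbTE xe) add0n; apply: leq_trans (islack _ _ _ BQ eS eB fB) _.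
  by rewrite ltnS leq_addl.
- move=> f of_; rewrite cost_cons; case xf: (conf x f).
    by move=> _; exists x => //; rewrite mem_head.
  rewrite add0n => /iheld[] // e eS ef; exists e => //.
  rewrite inE mem_rev mem_filter eS andbT; apply/orP; right.
  by apply: contraFN xf => xe; apply: conf_trans xe ef => //; apply: iopt.
- by move=> e; rewrite inE => /predU1P[-> //|/ilog].
- move=> e oe; rewrite cost_cons; case xe: (conf x e); last by rewrite add0n icost.
  by rewrite add1n -(cost_conf ilog ox oe xe).
Qed.

(** Since [conf] is reflexive, an element occurs in the log at most as often as its cost says. This
    bounds the number of bids. *)
Lemma size_auction_log S log : auction_inv S log -> size log <= #|T| * #|Q|.
Proof.
case=> _ _ _ _ ilog icost.
have -> : size log = \sum_(e : T) count_mem e log.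
  elim: log {ilog icost} => [|x s IH] /=; first by rewrite big1.
  rewrite big_split /= -IH (bigD1 x) //= eqxx big1 ?addn0 ?add1n // => e ne.
  by rewrite eq_sym (negbTE ne).
rewrite -sum_nat_const; apply: leq_sum => e _.
have [el|nel] := boolP (e \in log); last by rewrite (count_memPn nel).
apply: leq_trans (icost _ (ilog _ el)).
by apply: sub_count => f /eqP ->.
Qed.

End Auction.

(** * The branching *)

Lemma ffindP (T : eqType) U (f : T -> option U) (s : seq T) :
  if ffind f s is Some y then exists2 x, x \in s & f x = Some y
  else forall x, x \in s -> f x = None.
Proof.
rewrite /ffind.
suff H r : if foldl (fun r x => if f x is Some y then Some y else r) r s is Some y
    then r = Some y \/ exists2 x, x \in s & f x = Some y
    else r = None /\ forall x, x \in s -> f x = None.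
  by have := H None; case: foldl => [y|] [].
elim: s r => [|x s IH] r /=; first by case: r => [y|]; [left|split].
have := IH (if f x is Some y then Some y else r); case: foldl => [y|].
  case fx: (f x) => [z|] [].
  - by move=> [<-]; right; exists x; rewrite ?mem_head.
  - by move=> [w ws fw]; right; exists w; rewrite // inE ws orbT.
  - by left.
  - by move=> [w ws fw]; right; exists w; rewrite // inE ws orbT.
case fx: (f x) => [z|] [] // -> H; split=> // w.
by rewrite inE => /predU1P[-> //|/H].
Qed.

Lemma foldl_map_cons (A B : Type) (g : A -> B) (s : seq A) acc :
  foldl (fun acc d => g d :: acc) acc s = catrev (map g s) acc.
Proof. by elim: s acc => //= x s IH acc; rewrite IH. Qed.

Lemma mem_catrev (A : eqType) (s t : seq A) x :
  (x \in catrev s t) = (x \in s) || (x \in t).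
Proof. by rewrite catrevE mem_cat mem_rev. Qed.

Lemma foldl_allpairs A B C (f : A -> B * C -> A) a s t :
  foldl (fun r v => foldl (fun r w => f r (v, w)) r t) a s =
  foldl f a [seq (v, w) | v <- s, w <- t].
Proof.
elim: s a => //= v s IH a; rewrite foldl_cat IH; congr foldl.
by elim: t a {IH} => //= w t IH a; rewrite IH.
Qed.

Section Search.
Variables (G : sgraph) (P : {set {set G}}) (k D L : nat).
Hypothesis DL : D <= L.

Implicit Types (c : cand G) (u v w a : G).

Local Notation decided := (decided L).
Local Notation p3_at := (p3_at L).
Local Notation p3 := (p3 L).
Local Notation small := (small G k D).
Local Notation palette := (palette G k).

Lemma mem_verts v : v \in verts G.
Proof. by rewrite mem_rev mem_enum. Qed.

Lemma decidedE c v : size c <= L -> decided c v = (v \in unzip1 c).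
Proof.
move=> cL; rewrite /decided take_oversize // -has_pred1 has_map.
by apply: eq_has.
Qed.

Lemma p3_some c t : p3 c = Some t -> p3_at c t.1 t.2.1 t.2.2.
Proof.
rewrite /p3 => e; have := ffindP (fun u => ffind (fun v => ffind (fun w =>
    if p3_at c u v w then Some (u, (v, w)) else None) (verts G)) (verts G)) (verts G).
rewrite e => -[u _ eu]; have := ffindP (fun v => ffind (fun w =>
    if p3_at c u v w then Some (u, (v, w)) else None) (verts G)) (verts G).
rewrite eu => -[v _ ev]; have := ffindP (fun w =>
    if p3_at c u v w then Some (u, (v, w)) else None) (verts G).
by rewrite ev => -[w _]; case: ifP => // + [<-].
Qed.

Lemma p3_none c u v w : p3 c = None -> ~~ p3_at c u v w.
Proof.
rewrite /p3 => e; have := ffindP (fun u => ffind (fun v => ffind (fun w =>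
    if p3_at c u v w then Some (u, (v, w)) else None) (verts G)) (verts G)) (verts G).
rewrite e => /(_ u (mem_verts u)) eu; have := ffindP (fun v => ffind (fun w =>
    if p3_at c u v w then Some (u, (v, w)) else None) (verts G)) (verts G).
rewrite eu => /(_ v (mem_verts v)) ev; have := ffindP (fun w =>
    if p3_at c u v w then Some (u, (v, w)) else None) (verts G).
by rewrite ev => /(_ w (mem_verts w)); case: ifP.
Qed.

Lemma palette_uniq : uniq palette.
Proof. by rewrite /palette truncateE rev_uniq take_uniq // rev_uniq enum_uniq. Qed.

Lemma size_palette : size palette = minn k #|G|.
Proof. by rewrite size_truncate size_rev -cardE. Qed.

Lemma size_small : size small <= D.
Proof. by rewrite size_truncate geq_minl. Qed.

Lemma small_palette : {subset small <= palette}.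
Proof.
have -> : small = rev (take D palette) by exact: truncateE.
by move=> v; rewrite mem_rev; apply: mem_take.
Qed.

Definition rounds i : seq (cand G) :=
  iter i (fun cs => foldl (fun acc c => branch k D L acc c) [::] (take L cs)) [:: [::]].

Definition child c z : Prop :=
  if p3 c is Some t then
    exists y d, [/\ y \in [:: t.1; t.2.1; t.2.2],
      d \in None :: map Some small & z = (y, d) :: c]
  else z = c.

Lemma mem_branch acc c z :
  z \in branch k D L acc c <-> z \in acc \/ child c z.
Proof.
rewrite /branch /child; case: (p3 c) => [[u [v w]]|] /=; last first.
  by rewrite inE; split=> [/predU1P[]|[->|->]]; rewrite ?eqxx ?orbT; auto.
rewrite !foldl_map_cons !(mem_catrev, inE).
have H y : z \in [seq (y, Some d) :: c | d <- small] \/ z = (y, None) :: c <->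
    exists2 d, d \in None :: map Some small & z = (y, d) :: c.
  split=> [[/mapP[d ds ->]|->]|[d]].
  - by exists (Some d); rewrite // inE map_f.
  - by exists None; rewrite ?mem_head.
  - by rewrite inE => /predU1P[->|/mapP[a as_ ->]] ->; [right|left; apply: map_f].
split.
  move=> h; have : z \in acc \/ exists y, (y \in [:: u; v; w]) /\
      (z \in [seq (y, Some d) :: c | d <- small] \/ z = (y, None) :: c).
    case/or3P: h => [h|/eqP h|/or3P[h|/eqP h|/or3P[h|/eqP h|h]]]; auto; right.
    - by exists w; rewrite !inE eqxx !orbT; auto.
    - by exists w; rewrite !inE eqxx !orbT; auto.
    - by exists v; rewrite !inE eqxx !orbT; auto.
    - by exists v; rewrite !inE eqxx !orbT; auto.
    - by exists u; rewrite !inE eqxx; auto.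
    - by exists u; rewrite !inE eqxx; auto.
  by case=> [|[y [yi /H[d di zd]]]]; [left|right; exists y, d].
case=> [->|[y [d [yi di zd]]]]; first by rewrite !orbT.
have /H : exists2 d, d \in None :: map Some small & z = (y, d) :: c by exists d.
by move: yi; rewrite !inE => /or3P[] /eqP -> [->|->]; rewrite ?eqxx ?orbT.
Qed.

Lemma mem_branches acc cs z :
  z \in foldl (fun acc c => branch k D L acc c) acc cs <->
  z \in acc \/ exists2 c, c \in cs & child c z.
Proof.
elim: cs acc => [|c cs IH] acc /=; first by split; [left|case=> // -[]].
rewrite IH mem_branch; split.
- case=> [[|h]|[d dcs h]]; [by left|right|right].
    by exists c; rewrite ?mem_head.
  by exists d; rewrite // inE dcs orbT.
- case=> [|[d]]; first by left; left.
  by rewrite inE => /predU1P[->|dcs] h; [left; right|right; exists d].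
Qed.

(** Each of the three vertices has at most [D.+1] roles: unselected, or one of at most [D]
    colours. *)
Lemma size_branch acc c : size (branch k D L acc c) <= size acc + 3 * D.+1.
Proof.
rewrite /branch; case: p3 => [t|] /=; last by lia.
rewrite !foldl_map_cons !catrevE /= !(size_cat, size_rev, size_map) /=.
by do ![rewrite !(size_cat, size_rev, size_map) /=]; have := size_small; lia.
Qed.

Lemma size_rounds i : size (rounds i) <= (3 * D.+1) ^ i.
Proof.
elim: i => //= i IH; rewrite expnS.
have H acc cs : size (foldl (fun acc c => branch k D L acc c) acc cs) <=
    size acc + size cs * (3 * D.+1).
  elim: cs acc => [|c cs IHc] acc /=; first by lia.
  by apply: leq_trans (IHc _) _; have := size_branch acc c; lia.
apply: leq_trans (H _ _) _; rewrite add0n mulnC leq_mul2l; apply/orP; right.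
by apply: leq_trans IH; rewrite size_take_min geq_minr.
Qed.

Lemma rounds_size i c : c \in rounds i -> size c <= i.
Proof.
elim: i c => [|i IH] c /=; first by rewrite inE => /eqP ->.
case/mem_branches => // -[d /mem_take /IH ld]; rewrite /child; case: p3 => [t|].
  by case=> y [e [_ _ ->]].
by move=> ->; apply: leqW.
Qed.

Lemma rounds_small i c v a : c \in rounds i -> (v, Some a) \in c -> a \in small.
Proof.
elim: i c => [|i IH] c /=; first by rewrite inE => /eqP ->.
case/mem_branches => // -[d /mem_take /IH ld]; rewrite /child; case: p3 => [t|].
  case=> y [e [_ es ->]]; rewrite inE => /predU1P[[_ ea]|//].
  by move: es; rewrite -ea inE /= => /mapP[b bs [->]].
by move=> ->.
Qed.

(** Given a target deletion set [U] with roles [delta], follow the branch that agrees with it: every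
    induced P3 meets [U], and a vertex of it in [U] is deleted with its role under [delta]. Only
    undecided vertices are chosen, so no vertex repeats. *)
Lemma rounds_complete (U : {set G}) (delta : G -> option G) i :
  (3 * D.+1) ^ D <= L -> i <= D ->
  (forall v a, v \in U -> delta v = Some a -> a \in small) ->
  (forall u v w, u \notin U -> v \notin U -> w \notin U ->
     edge u v -> edge v w -> u != w -> edge u w) ->
  exists c, [/\ c \in rounds i, p3 c = None \/ size c = i, uniq (unzip1 c)
    & forall v d, (v, d) \in c -> v \in U /\ d = delta v].
Proof.
move=> DL3; elim: i => [|i IH] iD small_delta cl.
  by exists [::]; split; rewrite ?mem_head //; right.
have [c [ci sc uc dc]] := IH (ltnW iD) small_delta cl.
have tci : c \in take L (rounds i).
  rewrite take_oversize //; apply: leq_trans (size_rounds i) _.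
  by apply: leq_trans DL3; rewrite leq_pexp2l // ltnW.
have cL : size c <= L by apply: leq_trans (rounds_size ci) _; lia.
case p3c: (p3 c) => [t|]; last first.
  exists c; split=> //; last by left.
  by apply/mem_branches; right; exists c; rewrite // /child p3c.
have [y yt yU] : exists2 y, y \in [:: t.1; t.2.1; t.2.2] & y \in U.
  have /and5P[_ _ _ e1 /and3P[e2 ne e3]] := p3_some p3c.
  have [?|n1] := boolP (t.1 \in U); first by exists t.1; rewrite ?inE ?eqxx.
  have [?|n2] := boolP (t.2.1 \in U); first by exists t.2.1; rewrite ?inE ?eqxx ?orbT.
  have [?|n3] := boolP (t.2.2 \in U); first by exists t.2.2; rewrite ?inE ?eqxx ?orbT.
  by rewrite (cl _ _ _ n1 n2 n3 e1 e2 ne) in e3.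
have yc : y \notin unzip1 c.
  have /and4P[n1 n2 n3 _] := p3_some p3c.
  by move: yt n1 n2 n3; rewrite !decidedE // !inE => /or3P[] /eqP ->.
exists ((y, delta y) :: c); split.
- apply/mem_branches; right; exists c => //; rewrite /child p3c.
  exists y, (delta y); split=> //; rewrite inE.
  case e: (delta y) => [a|//]; apply/orP; right.
  by rewrite map_f //; apply: small_delta e.
- by right=> /=; case: sc => [|->] //; rewrite p3c.
- by rewrite /= yc.
- by move=> v d; rewrite inE => /predU1P[[-> ->]|/dc].
Qed.

End Search.

(** * Selections and colourings *)

Definition p3_free (G : sgraph) (U : {set G}) : Prop :=
  forall u v w : G, u \notin U -> v \notin U -> w \notin U ->
    edge u v -> edge v w -> u != w -> edge u w.

Lemma cluster_p3_free (G : sgraph) (U : {set G}) :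
  is_cluster (induced (~: U)) <-> p3_free U.
Proof.
split=> [cl u v w|pf].
  rewrite -!in_setC => uU vU wU uv vw uw.
  pose x := exist (fun z => z \in ~: U) u uU : induced (~: U).
  pose y := exist (fun z => z \in ~: U) v vU : induced (~: U).
  pose z := exist (fun z => z \in ~: U) w wU : induced (~: U).
  have xz : connect (@edge (induced (~: U))) x z.
    by apply: (@connect_trans _ _ y); apply: connect1.
  by move/forallP/(_ x)/forallP/(_ z): cl; rewrite xz -val_eqE uw.
apply/forallP => x; apply/forallP => y; apply/implyP => /connectP[p + ->].
(* Induction along the path: the first edge and the shortcut of the rest combine into one edge. *)
suff H : path (@edge (induced (~: U))) x p -> (x == last x p) || edge x (last x p).
  by move=> /H /orP[/eqP <-|->]; rewrite ?eqxx ?implybT.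
elim: p x => [|z p IH] x /=; first by rewrite eqxx.
case/andP=> xz /IH /orP[/eqP <-|zl]; first by rewrite xz orbT.
have [//|ne] := eqVneq x (last z p).
have out (t : induced (~: U)) : val t \notin U by rewrite -in_setC (valP t).
by apply: (pf _ _ _ (out x) (out z) (out _) xz zl).
Qed.

Section Correctness.
Variables (G : sgraph) (P : {set {set G}}) (k D L : nat).
Hypotheses (partP : partition P [set: G]) (DL : D <= L).

Implicit Types (c : cand G) (u v w a : G) (e f : G * G) (A B : {set G}).

Local Notation small := (small G k D).
Local Notation palette := (palette G k).
Local Notation sel := (sel L).
Local Notation price := (price L).
Local Notation usable := (usable L).

Lemma part_inj A B v : A \in P -> B \in P -> v \in A -> v \in B -> A = B.
Proof.
have /and3P[_ tP _] := partP.
by move=> AP BP vA vB; rewrite -(def_pblock tP AP vA) (def_pblock tP BP vB).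
Qed.

(** A solution in the format of the candidates: [Some a] is a selected vertex with colour [a],
    [None] an unselected one. *)
Record selection (delta : G -> option G) : Prop := Selection {
  sel_part : forall A, A \in P -> exists v a, v \in A /\ delta v = Some a;
  sel_uniq : forall A v w a b, A \in P -> v \in A -> w \in A ->
    delta v = Some a -> delta w = Some b -> v = w;
  sel_proper : forall v w a, edge v w -> delta v = Some a -> delta w <> Some a;
  sel_palette : forall v a, delta v = Some a -> a \in palette }.

(** Colours are renamed by listing those used on [U] first. *)
Lemma selection_exists (U : {set G}) :
  selective_colorable P k -> #|U| <= D ->
  exists2 delta, selection delta &
    forall v a, v \in U -> delta v = Some a -> a \in small.
Proof.
case=> X [HX [f fP]] UD.
pose SU := [set f x | x in [set x : induced X | val x \in U]].
pose S := [set f x | x in [set: induced X]].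
pose s := enum SU ++ enum (S :\: SU).
have subS : SU \subset S.
  by apply/subsetP => _ /imsetP[x _ ->]; apply: imset_f; rewrite inE.
have us : uniq s.
  rewrite cat_uniq !enum_uniq andbT /=; apply/hasPn => t.
  by rewrite /= !mem_enum inE => /andP[].
have ms x : f x \in s.
  rewrite mem_cat !mem_enum inE -/(f x); case: (f x \in SU) => //=.
  by apply: imset_f; rewrite inE.
have size_s : size s <= size palette.
  have -> : size s = #|S|.
    rewrite size_cat -!cardE -(cardsID SU S); congr (_ + _).
    by rewrite (setIidPr subS).
  rewrite size_palette leq_min; apply/andP; split.
    by rewrite -[X in _ <= X]card_ord max_card.
  apply: leq_trans (leq_imset_card _ _) _; rewrite cardsT card_sig.
  exact: max_card.
have idx x : index (f x) s < size palette.
  by apply: leq_trans size_s; rewrite index_mem.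
pose delta v := if insub v is Some x then Some (nth v palette (index (f x) s)) else None.
have deltaP v a : delta v = Some a ->
    exists2 x : induced X, val x = v & a = nth v palette (index (f x) s).
  by rewrite /delta; case: insubP => // x _ <- [<-]; exists x.
have deltaX (x : induced X) : delta (val x) = Some (nth (val x) palette (index (f x) s)).
  by rewrite /delta valK.
exists delta; first split.
- move=> A /HX/eqP/cards1P[v] /setP /(_ v); rewrite !inE eqxx => /andP[vX vA].
  pose x : induced X := exist _ v vX.
  by exists v, (nth v palette (index (f x) s)); rewrite -(deltaX x).
- move=> A v w a b /HX/eqP/cards1P[z] E vA wA /deltaP[x xv _] /deltaP[y yw _].
  have /setP H := E; have := H v; have := H w.
  by rewrite !inE vA wA -xv -yw (valP x) (valP y) /= => /esym/eqP -> /esym/eqP ->.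
- move=> v w a vw /deltaP[x xv ->] /deltaP[y yw] e.
  have xy : @edge (induced X) x y by rewrite -xv -yw in vw.
  apply: (fP x y xy); apply/eqP; have := e.
  rewrite (set_nth_default v _ (idx y)) => /eqP.
  rewrite nth_uniq ?palette_uniq // => /eqP e2.
  by rewrite -(nth_index (f x) (ms x)) e2 nth_index.
- by move=> v a /deltaP[x _ ->]; rewrite mem_nth.
move=> v a vU /deltaP[x xv ->].
have -> : small = rev (take D palette) by exact: truncateE.
rewrite mem_rev; have lt : index (f x) s < D.
  have fU : f x \in enum SU by rewrite mem_enum imset_f // inE xv.
  rewrite index_cat fU; apply: leq_trans (_ : #|SU| <= _).
    by rewrite cardE index_mem.
  apply: leq_trans (leq_imset_card _ _) _; apply: leq_trans UD.
  rewrite -(card_imset _ val_inj); apply/subset_leq_card/subsetP => _ /imsetP[y + ->].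
  by rewrite inE.
by rewrite -(nth_take _ lt) mem_nth // size_take_min leq_min lt idx.
Qed.

(** The colour of a vertex becomes the position in [palette] of the vertex paired with it, which is
    below [k]. *)
Lemma selective_colorable_list (s : seq (G * G)) :
  (forall A, A \in P -> exists2 e, e \in s & e.1 \in A) ->
  (forall e f, e \in s -> f \in s -> e <> f ->
     ~~ clash e f /\ forall A, A \in P -> e.1 \in A -> f.1 \notin A) ->
  (forall e, e \in s -> e.2 \in palette) ->
  selective_colorable P k.
Proof.
move=> cov sep pal; exists [set v in unzip1 s]; split.
  move=> A AP; have [e es eA] := cov A AP.
  apply/eqP/cards1P; exists e.1; apply/setP => v; rewrite !inE.
  apply/andP/eqP => [[/mapP[g gs ->] gA]|->]; last by rewrite map_f.
  have [->//|/eqP ne] := eqVneq g e.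
  by have [_ /(_ _ AP gA)] := sep _ _ gs es ne; rewrite eA.
pose col v := nth v (unzip2 s) (index v (unzip1 s)).
have colP v : v \in unzip1 s -> (v, col v) \in s.
  move=> vs; have lt : index v (unzip1 s) < size s by rewrite -(size_map fst) index_mem.
  have -> : (v, col v) = nth (v, v) s (index v (unzip1 s)).
    rewrite /col (nth_map (v, v)) //.
    rewrite -{1}(nth_index v vs) (nth_map (v, v)) //.
    by case: (nth _ _ _).
  by rewrite mem_nth.
have colk (x : induced [set v in unzip1 s]) : index (col (val x)) palette < k.
  have := valP x; rewrite inE => /colP /pal /=.
  rewrite -index_mem => lt; apply: leq_trans lt _.
  by rewrite size_palette geq_minl.
exists (fun x => Ordinal (colk x)) => x y xy [] /eqP.
have := valP x; have := valP y; rewrite !inE => ys xs.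
have px : col (val x) \in palette := pal _ (colP _ xs).
have py : col (val y) \in palette := pal _ (colP _ ys).
move=> /eqP e; have {e} ce : col (val x) = col (val y).
  by rewrite -(nth_index (val x) px) e nth_index.
have xy' : @edge G (val x) (val y) by [].
have [E|/eqP ne] := eqVneq (val x, col (val x)) (val y, col (val y)).
  by have exy : val x = val y := congr1 fst E; rewrite exy edge_irr in xy'.
by have [] := sep _ _ (colP _ xs) (colP _ ys) ne; rewrite /clash /= xy' ce eqxx.
Qed.

Lemma selE c v a : size c <= L -> ((v, a) \in sel c) = ((v, Some a) \in c).
Proof.
move=> cL; rewrite /(sel c) take_oversize // -[RHS]orbF -[in RHS](in_nil (v, a)).
elim: c {cL} [::] => [|[w [b|]] c IH] acc //=; rewrite IH !inE.
  by rewrite orbCA orbA; congr (_ || _); rewrite !xpair_eqE.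
by rewrite xpair_eqE andbF.
Qed.

Lemma size_sel c : size (sel c) <= size c.
Proof.
apply: leq_trans (_ : size (take L c) <= _); last by rewrite size_take_min geq_minr.
rewrite /(sel c) -[X in _ <= X]addn0 -[0]/(size (Nil (G * G))).
elim: (take L c) [::] => [|[w [b|]] s IH] acc //=.
  by apply: leq_trans (IH _) _; rewrite /= addnS.
by apply: leq_trans (IH _) _; rewrite addSn.
Qed.

Lemma hitP (s : seq (G * G)) A : size s <= L ->
  reflect (exists2 e, e \in s & e.1 \in A) (hit L s A).
Proof. by move=> sL; rewrite /hit take_oversize //; apply: hasP. Qed.

Definition opt c A e := [&& e.1 \in A, usable c e & e.2 \in palette].

Lemma mem_options e : (e \in [seq (v, a) | v <- verts G, a <- palette]) = (e.2 \in palette).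
Proof.
case: e => v a; apply/allpairsP/idP => [[[w b] /= [_ bp [_ ->]]] //|ap].
by exists (v, a); split=> //=; apply: mem_verts.
Qed.

Lemma bestP c log A :
  if best k L c log A is Some x
  then opt c A x /\ forall y, opt c A y -> price log x <= price log y
  else forall y, ~~ opt c A y.
Proof.
rewrite /best; set F := (fun r v => _).
pose F2 r e := if (e.1 \in A) && usable c e then cheaper L log r e else r.
have -> : foldl F None (verts G) =
    foldl F2 None [seq (v, a) | v <- verts G, a <- palette].
  by rewrite -foldl_allpairs.
set s := [seq (v, a) | v <- verts G, a <- palette].
have H r : if foldl F2 r s is Some x
    then (r = Some x \/ [/\ x \in s, x.1 \in A & usable c x]) /\
         (forall y, y \in s -> y.1 \in A -> usable c y -> price log x <= price log y) /\
         (forall z, r = Some z -> price log x <= price log z)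
    else r = None /\ forall y, y \in s -> ~~ ((y.1 \in A) && usable c y).
  elim: s r => [|e s IH] r /=.
    by case: r => [x|]; split=> //; [left|split=> // z [->]].
  have from y : F2 r e = Some y ->
      r = Some y \/ [/\ y = e, e.1 \in A & usable c e].
    rewrite /F2; case: ifP => [/andP[eA ue]|_]; last by left.
    rewrite /cheaper; case: r => [z|]; last by case=> <-; right.
    by case: ifP => _ [<-]; [right|left].
  have below_e : e.1 \in A -> usable c e ->
      exists2 y, F2 r e = Some y & price log y <= price log e.
    rewrite /F2 /cheaper => -> -> /=; case: r {from} => [z|]; last by exists e.
    by case: ifP => [_|/negbT]; [exists e|rewrite -leqNgt; exists z].
  have below_r z : r = Some z -> exists2 y, F2 r e = Some y & price log y <= price log z.
    rewrite /F2 /cheaper => ->; case: ifP => _; last by exists z.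
    by case: ifP => [/ltnW|_]; [exists e|exists z].
  have := IH (F2 r e); case: foldl => [x|]; last first.
    case=> n Hs; split.
      by case: r below_r n {from below_e IH Hs} => [z /(_ _ erefl)[w -> _]|].
    move=> y; rewrite inE => /predU1P[->|/Hs //]; apply/negP => /andP[eA ue].
    by have [z] := below_e eA ue; rewrite n.
  case=> Hx [Hs Hr]; split.
    case: Hx => [/from[|[-> eA ue]]|[xs xA ux]]; first by left.
      by right; rewrite mem_head.
    by right; rewrite inE xs orbT.
  split=> [y|z /below_r[y /Hr H le]]; last exact: leq_trans le.
  rewrite inE => /predU1P[->|]; last exact: Hs.
  by move=> eA ue; have [z /Hr H le] := below_e eA ue; apply: leq_trans le.
have := H None; case: foldl => [x|].
  case=> -[//|[xs xA ux]] [Hs _]; split=> [|y].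
    by rewrite /opt xA ux -mem_options.
  by case/and3P => yA uy; rewrite -mem_options => ys; apply: Hs.
case=> _ Hs y; apply/negP => /and3P[yA uy]; rewrite -mem_options => /Hs.
by rewrite yA uy.
Qed.

Lemma pendingP c s :
  if pending P L c s is Some A
  then [/\ A \in P, ~~ hit L (sel c) A & ~~ hit L s A]
  else forall A, A \in P -> hit L (sel c) A || hit L s A.
Proof.
have := ffindP (fun A => if hit L (sel c) A || hit L s A then None else Some A) (enum P).
rewrite /pending; case: ffind => [A|].
  case=> B; rewrite mem_enum; case: ifP => // /negbT.
  by rewrite negb_or => /andP[h1 h2] BP [<-].
by move=> H A AP; have := H A; rewrite mem_enum AP => /(_ isT); case: ifP.
Qed.

Definition state c i := iter i (bid P k L c) ([::], [::]).

(** Each round lengthens either list by at most one, so during the first [L] rounds the truncations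
    to [L] have no effect. *)
Lemma size_state c i : size (state c i).1 <= i /\ size (state c i).2 <= i.
Proof.
clear partP DL; elim: i => //= i [IH1 IH2]; rewrite /bid -/(state c i).
case: pending => [A|]; last by lia.
case: best => [x|]; last by lia.
split=> /=; last by lia.
rewrite size_rev size_filter; apply: leq_ltn_trans (count_size _ _) _.
by rewrite size_take_min; lia.
Qed.

End Correctness.

(** * Correctness of the algorithm *)

Section Feasible.
Variables (G : sgraph) (P : {set {set G}}) (k D L : nat).
Hypotheses (partP : partition P [set: G]) (DL : D <= L).

Implicit Types (c : cand G) (u v w a : G) (e f : G * G) (A B : {set G}).

Local Notation small := (small G k D).
Local Notation palette := (palette G k).
Local Notation sel := (sel L).
Local Notation price := (price L).
Local Notation usable := (usable L).
Local Notation opt := (opt k L).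
Local Notation state := (state P k L).

Lemma clashC e f : clash e f = clash f e.
Proof. by rewrite /clash edge_sym eq_sym. Qed.

Lemma clash_conf e f : clash e f -> conf e f.
Proof. by rewrite /clash /conf => /andP[-> ->]; rewrite orbT. Qed.

Lemma confC : symmetric (@conf G).
Proof. by move=> e f; rewrite /conf edge_sym eq_sym [e.1 == _]eq_sym. Qed.

Lemma usableP c e : size c <= L -> reflect
  (e.1 \notin unzip1 c /\ forall f, f \in sel c -> ~~ clash e f) (usable c e).
Proof.
move=> cL; rewrite /usable decidedE // take_oversize; last exact: leq_trans (size_sel _ _) cL.
by apply: (iffP andP) => -[? H]; split=> //; [apply/hasPn|apply/hasPn].
Qed.

Lemma bid_cases c i : i <= L ->
  let: (s, log) := state c i in
  (state c i.+1 = (s, log) /\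
     ((forall A, A \in P -> hit L (sel c) A || hit L s A) \/
      exists A, [/\ A \in P, ~~ hit L (sel c) A & forall x, ~~ opt c A x])) \/
  exists A x, [/\ A \in P, ~~ hit L (sel c) A, forall e, e \in s -> e.1 \notin A,
    opt c A x /\ (forall y, opt c A y -> price log x <= price log y) &
    state c i.+1 = (x :: rev [seq e <- s | ~~ conf x e], x :: log)].
Proof.
move=> iL; have [] := size_state P k L c i; rewrite [state c i.+1]/= -/(state c i).
case: (state c i) => s log /= ls _; have sL : size s <= L by apply: leq_trans iL.
rewrite /bid /=; have := pendingP P L c s; case: pending => [A|]; last by left; split; auto.
case=> AP nA ns; have nsA e : e \in s -> e.1 \notin A.
  by move=> es; apply: contra ns => eA; apply/hitP => //; exists e.
have := bestP k L c log A; case: best => [x [ox mx]|no].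
  by right; exists A, x; rewrite /= take_oversize.
by left; split=> //; right; exists A.
Qed.

(** A bid evicts everything in conflict with it and comes from a part not hit so far, so held pairs
    are compatible with each other; being usable, they are compatible with the pairs fixed by [c].
    No optimality of the auction enters. *)
Lemma feasible_sound c :
  size c <= L -> (forall v a, (v, Some a) \in c -> a \in palette) ->
  feasible P k L c -> selective_colorable P k.
Proof.
move=> cL pal /andP[val cov].
have selL : size (sel c) <= L by apply: leq_trans (size_sel _ _) cL.
have inv i : i <= L ->
    (forall e, e \in (state c i).1 ->
       exists A, [/\ A \in P, ~~ hit L (sel c) A & opt c A e]) /\
    (forall e f, e \in (state c i).1 -> f \in (state c i).1 -> e <> f ->
       ~~ clash e f /\ forall A, A \in P -> e.1 \in A -> f.1 \notin A).
  elim: i => // i IH iL; have := bid_cases c (ltnW iL); have := IH (ltnW iL).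
  case: (state c i) => s log /= [I1 I2] [[-> _] //|[A [x [AP nA nsA [ox _] ->]]]] /=.
  have new e : e \in s -> ~~ conf x e ->
      ~~ clash x e /\ forall B, B \in P -> x.1 \in B -> e.1 \notin B.
    move=> es xe; split=> [|B BP xB]; first by apply: contra xe => /clash_conf.
    have /and3P[xA _ _] := ox.
    by rewrite (part_inj partP BP AP xB xA) nsA.
  split=> [e|e f]; rewrite !inE !mem_rev !mem_filter.
    by case/predU1P=> [->|/andP[_ /I1 //]]; exists A.
  case/predU1P=> [->|/andP[xe es]] /predU1P[->|/andP[xf fs]] // ne; last exact: I2.
    exact: new.
  have [n1 n2] := new _ es xe; split; first by rewrite clashC.
  by move=> B BP eB; apply/negP => xB; have := n2 _ BP xB; rewrite eB.
have [I1 I2] := inv L (leqnn L); have [szS _] := size_state P k L c L.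
have usS e : e \in auction P k L c ->
    [/\ forall f, f \in sel c -> ~~ clash e f, e.2 \in palette &
        forall f A, f \in sel c -> A \in P -> e.1 \in A -> f.1 \notin A].
  move=> /I1[A [AP nA /and3P[eA /(usableP _ cL)[_ H] ep]]]; split=> // f B fs BP eB.
  rewrite (part_inj partP BP AP eB eA); apply: contra nA => fA.
  by apply/hitP => //; exists f.
apply: (selective_colorable_list (s := sel c ++ auction P k L c)).
- move=> A AP; have /allP/(_ A) := cov; rewrite mem_enum AP => /(_ isT).
  by case/orP=> /hitP[] // e es eA; exists e; rewrite // mem_cat es ?orbT.
- move=> e f; rewrite !mem_cat => /orP[es|es] /orP[fs|fs] ne; last exact: I2.
  + move: val; rewrite /valid take_oversize // => /allP/(_ e es)/allP/(_ f fs).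
    case/orP=> [/andP[/eqP e1 /eqP e2]|]; first by case: ne; apply/eqP; rewrite [e == f]/eq_op /= e1 e2 !eqxx.
    rewrite negb_or => /andP[-> /hasPn nt]; split=> // A AP eA.
    by have := nt A; rewrite mem_enum AP eA => /(_ isT).
  + have [H1 _ H2] := usS _ fs; rewrite clashC; split; first exact: H1.
    move=> A AP eA; apply/negP => fA.
    by have := H2 _ _ es AP fA; rewrite eA.
  + have [H1 _ H2] := usS _ es; split; first exact: H1.
    by move=> A AP eA; apply: H2 eA.
- move=> [v a]; rewrite mem_cat => /orP[|/usS[] //]; rewrite selE //; exact: pal.
Qed.

Lemma card_parts : #|P| <= #|G|.
Proof.
rewrite -cardsT (card_partition partP) -sum1_card; apply: leq_sum => A AP.
have /and3P[_ _ n0] := partP; rewrite card_gt0.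
by apply: contraNneq n0 => <-.
Qed.

(** The vertices selected by [delta] in the parts not yet hit form the matching [m] of the auction.
    As long as a part is pending, every round makes a bid, but the log has at most [#|G| ^ 3]
    entries, fewer than the [L] rounds. *)
Lemma feasible_complete c delta :
  size c <= L -> #|G| ^ 3 < L -> p3 L c = None -> selection P k delta ->
  (forall v d, (v, d) \in c -> d = delta v) ->
  feasible P k L c.
Proof.
move=> cL nL p3c [dpart duniq dprop dpal] cdelta.
have selL : size (sel c) <= L by apply: leq_trans (size_sel _ _) cL.
have seld e : e \in sel c -> delta e.1 = Some e.2.
  by case: e => v a; rewrite selE // => /cdelta.
apply/andP; split.
  rewrite /valid take_oversize //; apply/allP => e es; apply/allP => f fs.
  have de := seld _ es; have df := seld _ fs.
  have [e1|ne] /= := eqVneq e.1 f.1.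
    by move: de; rewrite e1 df => -[->]; rewrite eqxx.
  rewrite negb_or; apply/andP; split.
    apply/negP => /andP[ef /eqP e2]; apply: (dprop _ _ _ ef de).
    by rewrite e2.
  apply/hasPn => A; rewrite mem_enum => AP; apply/negP => /andP[eA fA].
  by case/eqP: ne; apply: duniq AP eA fA de df.
apply/allP => A0; rewrite mem_enum; move: A0.
(* [v0] serves only as the default in [m]; in a graph without vertices there is no part to hit. *)
case: (pickP (fun _ : G => true)) => [v0 _|no]; last first.
  by move=> A AP; have [v] := dpart A AP; have := no v.
pose Q := [set A in P | ~~ hit L (sel c) A].
pose m A := let v := odflt v0 [pick v in A | delta v] in (v, odflt v0 (delta v)).
have mP A : A \in Q -> (m A).1 \in A /\ delta (m A).1 = Some (m A).2.
  rewrite inE => /andP[AP _]; rewrite /m; case: pickP => [v /andP[vA]|] /=.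
    by case: (delta v).
  by have [v [a [vA dv]]] := dpart A AP; move=> /(_ v); rewrite vA dv.
have QP A : A \in Q -> A \in P by rewrite inE => /andP[].
have mopt A : A \in Q -> opt c A (m A).
  move=> AQ; have [mA dm] := mP _ AQ; rewrite /(opt _ _) mA (dpal _ _ dm) andbT /=.
  apply/usableP => //; split.
    apply/negP => /mapP[[w d] wc mw]; have dw := cdelta _ _ wc.
    move: AQ; rewrite inE => /andP[_ /negP[]]; apply/hitP => //.
    exists (w, (m A).2); last by rewrite -[(w, _).1]mw.
    by rewrite selE // -dm mw -[(w, d).1]/w -dw.
  move=> f fs; apply/negP => /andP[ef /eqP e2]; apply: (dprop _ _ _ ef dm).
  by rewrite e2; apply: seld.
have minj A B : A \in Q -> B \in Q -> conf (m A) (m B) -> A = B.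
  move=> AQ BQ /andP[/eqP e2 H].
  have [mA dA] := mP _ AQ; have [mB dB] := mP _ BQ.
  case/orP: H => [/eqP e1|ed]; last by case: (dprop _ _ _ ed dA); rewrite dB e2.
  by rewrite -e1 in mB; apply: (part_inj partP (QP _ AQ) (QP _ BQ) mA mB).
have ctrans e f g : is_option Q (opt c) e -> is_option Q (opt c) f ->
    is_option Q (opt c) g -> conf e f -> conf f g -> conf e g.
  move=> [A _ /and3P[_ /andP[ue _] _]] [B _ /and3P[_ /andP[uf _] _]].
  move=> [C _ /and3P[_ /andP[ug _] _]] /andP[/eqP e2 H1] /andP[/eqP e3 H2].
  rewrite /conf e2 e3 eqxx /=.
  have [//|ne] := eqVneq e.1 g.1.
  case/orP: H1 => [/eqP e1|H1].
    by case/orP: H2 => [/eqP e1'|]; [case/eqP: ne; rewrite e1|rewrite e1].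
  case/orP: H2 => [/eqP <- //|H2].
  (* If [e.1] and [g.1] were not adjacent, the three vertices would form an undecided induced P3. *)
  have := p3_none e.1 f.1 g.1 p3c.
  by rewrite /p3_at ue uf ug H1 H2 ne /= negbK.
have confxx : reflexive (@conf G) by move=> e; rewrite /conf !eqxx.
have oinj A B e : A \in Q -> B \in Q -> opt c A e -> opt c B e -> A = B.
  move=> /QP AP /QP BP /and3P[eA _ _] /and3P[eB _ _].
  exact: (part_inj partP AP BP eA eB).
have inv i : i <= L ->
    auction_inv Q (opt c) (@conf G) (state c i).1 (state c i).2 /\
    (size (state c i).2 = i \/
     forall A, A \in P -> hit L (sel c) A || hit L (state c i).1 A).
  elim: i => [|i IH] iL; first by split; [apply: auction_inv_nil|left].
  have := bid_cases c (ltnW iL); have := IH (ltnW iL); have [_] := size_state P k L c i.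
  case: (state c i) => s log /= logi [I1 I2].
  case=> [[-> [cov|[A [AP nA /(_ (m A))]]]]|].
  - by split=> //; right.
  - by rewrite mopt // inE AP.
  case=> A [x [AP nA nsA [ox mx] E]]; rewrite E.
  have AQ : A \in Q by rewrite inE AP.
  split; last first.
    case: I2 => [<-|/(_ _ AP)]; first by left.
    rewrite (negbTE nA) /= => /hasP[e /mem_take es eA].
    by have := nsA _ es; rewrite eA.
  apply: (auction_step confxx confC ctrans oinj mopt minj I1 AQ) => //.
    by move=> e /nsA; rewrite /(opt _ _) => /negbTE ->.
  have priceE e : price log e = cost (@conf G) log e.
    by rewrite /(price log e) take_oversize //; lia.
  by move=> y /mx; rewrite !priceE.
have [I1 [sL|//]] := inv L (leqnn L).
have := size_auction_log confxx I1; rewrite sL card_prod => H.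
have : #|Q| <= #|G|.
  apply: leq_trans card_parts; apply/subset_leq_card/subsetP => A; exact: QP.
by move: nL H; rewrite !expnS expn0; nia.
Qed.

Lemma resultP :
  let r := result P k D L in let cs := take L (cands G k D L) in
  if r is Some b
  then (exists2 c, c \in cs & p3 L c = None) /\
       (b <-> exists c, [/\ c \in cs, p3 L c = None & feasible P k L c])
  else forall c, c \in cs -> p3 L c <> None.
Proof.
rewrite /result /=; elim/last_ind: (take _ _) => [|cs c IH] //=.
rewrite foldl_rcons; move: IH; set r := foldl _ _ _ => IH.
case p3c: (p3 L c) => [t|].
  case: r IH => [b [[d dcs pd] H]|H].
    split; first by exists d; rewrite // mem_rcons inE dcs orbT.
    rewrite H; split=> -[z [zi pz fz]]; exists z; split=> //.
      by rewrite mem_rcons inE zi orbT.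
    by move: zi; rewrite mem_rcons inE => /predU1P[zc|//]; rewrite zc p3c in pz.
  by move=> d; rewrite mem_rcons inE => /predU1P[->|/H //]; rewrite p3c.
split; first by exists c; rewrite // mem_rcons mem_head.
split.
  case/orP=> [fc|]; first by exists c; rewrite mem_rcons mem_head.
  case: r IH => // b [_ H] /H[d [di pd fd]].
  by exists d; rewrite mem_rcons inE di orbT.
case=> d [+ pd fd]; rewrite mem_rcons inE => /predU1P[<-|di]; first by rewrite fd.
case: r IH => [b [_ H]|/(_ _ di) //]; apply/orP; right.
by apply/H; exists d.
Qed.

Hypothesis searchL : (3 * D.+1) ^ D <= L.

Lemma take_cands : take L (cands G k D L) = rounds G k D L D.
Proof. by rewrite take_oversize //; apply: leq_trans searchL; apply: size_rounds. Qed.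

(** A branch that is not finished early has decided [D] distinct vertices of [U], hence all of [U],
    and no induced P3 is left outside [U]. *)
Lemma leaf_exists (U : {set G}) (delta : G -> option G) :
  #|U| <= D -> p3_free U ->
  (forall v a, v \in U -> delta v = Some a -> a \in small) ->
  exists c, [/\ c \in rounds G k D L D, p3 L c = None
    & forall v d, (v, d) \in c -> d = delta v].
Proof.
move=> UD pf sm; have [c [ci sc uc dc]] := rounds_complete DL searchL (leqnn D) sm pf.
have cL : size c <= L by apply: leq_trans (rounds_size ci) DL.
exists c; split=> //; last by move=> v d /dc[].
case: sc => // sc; case p3c: (p3 L c) => [t|] //; exfalso.
have cU v : v \in U -> v \in unzip1 c.
  have sub : {subset unzip1 c <= enum U}.
    by move=> w /mapP[[z d] /dc[zU _] ->]; rewrite mem_enum.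
  have le : size (enum U) <= size (unzip1 c) by rewrite -cardE size_map sc.
  by have [_ ->] := uniq_min_size uc sub le; rewrite mem_enum.
have out v : ~~ decided L c v -> v \notin U by rewrite decidedE //; apply/contra/cU.
have /and5P[/out n1 /out n2 /out n3 e1 /and3P[e2 ne e3]] := p3_some p3c.
by rewrite (pf _ _ _ n1 n2 n3 e1 e2 ne) in e3.
Qed.

Lemma result_not_none : dc G <= D -> result P k D L <> None.
Proof.
have [[U /cluster_p3_free pf <-] _] := dc_min G => UD r0.
(* With the target that selects nothing the condition on colours is vacuous. *)
have [//|c [ci pc _]] := leaf_exists (delta := fun=> None) UD pf.
by have := resultP; rewrite r0 take_cands => /(_ c ci).
Qed.

(** The vertices decided by any finished candidate can serve as the deletion set [U], so an answer
    is correct without comparing [D] with [dc G]. *)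
Lemma result_correct b : #|G| ^ 3 < L -> result P k D L = Some b ->
  b <-> selective_colorable P k.
Proof.
move=> nL r; have := resultP; rewrite r take_cands => -[[c ci pc] ->]; split.
  case=> d [di _]; apply: feasible_sound.
    exact: leq_trans (rounds_size di) DL.
  by move=> v a vd; apply: small_palette (rounds_small di vd).
move=> sc; have cL : size c <= L by apply: leq_trans (rounds_size ci) DL.
have UD : #|[set v in unzip1 c]| <= D.
  rewrite cardsE; apply: leq_trans (card_size _) _; rewrite size_map.
  exact: rounds_size ci.
have [delta sd dsm] := selection_exists sc UD.
have pf : p3_free [set v in unzip1 c].
  move=> u v w; rewrite !inE -!(decidedE _ cL) => uc vc wc uv vw uw.
  by have := p3_none u v w pc; rewrite /p3_at uc vc wc uv vw uw /= negbK.
have [d [di pd dd]] := leaf_exists UD pf dsm.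
exists d; split=> //; apply: feasible_complete dd => //.
exact: leq_trans (rounds_size di) DL.
Qed.

End Feasible.

(** * The program *)

(** The recursion looks at the spine only, so the first argument may be any list, standing for its
    length; this is how the adjacency matrix supplies the number of vertices. *)
Definition add_body (ia : nat) : expr :=
  EIf (ELeft (EVar 0))
    (ENode ELeaf (ECall ia (ENode (ERight (ELeft (EVar 0))) (ERight (EVar 0)))))
    (ERight (EVar 0)).

Definition mul_body (ia im : nat) : expr :=
  EIf (ELeft (EVar 0))
    (ECall ia (ENode (ERight (EVar 0))
      (ECall im (ENode (ERight (ELeft (EVar 0))) (ERight (EVar 0))))))
    ELeaf.

Lemma eval_add p ia : body p ia = add_body ia -> forall x n,
  eval_in p [:: Node x (encode_nat n)] (body p ia) (encode_nat (size (spine x) + n))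
    (20 * (size (spine x)).+1).
Proof.
move=> bi x n; elim: x => [|x0 _ x [t E le]]; rewrite {1}bi /=.
  by eexists; [apply: eval_if_leaf; exact: eval_simple|].
eexists; first apply: eval_if_node; first exact: eval_simple.
  apply: eval_node; first exact: eval_simple.
  by apply: eval_call; [exact: eval_simple|exact: E].
by rewrite /=; lia.
Qed.

Lemma eval_mul p ia im : body p ia = add_body ia -> body p im = mul_body ia im ->
  forall x y,
  eval_in p [:: Node x y] (body p im) (encode_nat (size (spine x) * size (spine y)))
    (50 * ((size (spine x)).+1 * (size (spine y)).+1)).
Proof.
move=> bi bm x y; elim: x => [|x0 _ x [t E le]]; rewrite {1}bm /=.
  by eexists; [apply: eval_if_leaf; exact: eval_simple|rewrite /=; lia].
have [t' E' le'] := eval_add bi y (size (spine x) * size (spine y)).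
rewrite mulSn; eexists; first apply: eval_if_node; first exact: eval_simple.
  apply: eval_call; last exact: E'.
  apply: eval_node; first exact: eval_simple.
  by apply: eval_call; [exact: eval_simple|exact: E].
by rewrite /=; nia.
Qed.

Lemma spine_encode_nat_size n : size (spine (encode_nat n)) = n.
Proof. by rewrite spine_encode_nat size_nseq. Qed.

Definition numeral (n : nat) (e : expr) : expr := iter n (ENode ELeaf) e.

Lemma eval_numeral p s e m t n : eval p s e (encode_nat m) t ->
  eval p s (numeral n e) (encode_nat (n + m)) (2 * n + t).
Proof.
move=> E; elim: n => [|n IH] //=.
have -> : 2 * n.+1 + t = (1 + (2 * n + t)).+1 by lia.
by apply: eval_node; first constructor.
Qed.

Definition tower (n : nat) : nat := 2 ^ 2 ^ n.

Lemma towerS n : tower n.+1 = tower n * tower n.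
Proof. by rewrite /tower expnS mul2n -addnn expnD. Qed.

Lemma leq_tower m n : m <= n -> tower m <= tower n.
Proof. by move=> mn; rewrite !leq_exp2l. Qed.

(** Repeated squaring, starting from [tower 0 = 2]. *)
Lemma computable_tower c : computable (fun n => tower (n + c)).
Proof.
pose tower_body := EIf (EVar 0)
  (ELet (ECall 3 (ERight (EVar 0))) (ECall 2 (ENode (EVar 0) (EVar 0))))
  (numeral 2 ELeaf).
exists [:: ECall 3 (numeral c (EVar 0)); add_body 1; mul_body 1 2; tower_body] => n.
set p := [:: _; _; _; _].
have Et m : exists t, eval p [:: encode_nat m] (body p 3) (encode_nat (tower m)) t.
  elim: m => [|m [t E]].
    by eexists; apply: eval_if_leaf; exact: eval_simple.
  have [t' E' _] := @eval_mul p 1 2 erefl erefl (encode_nat (tower m)) (encode_nat (tower m)).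
  rewrite !spine_encode_nat_size -towerS in E'.
  eexists; apply: eval_if_node; first exact: eval_simple.
  apply: eval_let; first by apply: eval_call E; exact: eval_simple.
  by apply: eval_call E'; exact: eval_simple.
have [t E] := Et (n + c); eexists; apply: eval_call E.
by rewrite addnC; apply: eval_numeral; apply: (eval_var p [:: encode_nat n] 0).
Qed.

(** In [search_arg D], on which the main loop operates, [tower D.+2] is the part of
    the fuel of the folds that grows with [D]; [round_expr h] decides whether [D] is
    large enough. *)
Definition round_expr (h : hexpr) : expr :=
  let inst := ERight (ERight (EVar 0)) in
  let n1 := ENode ELeaf (ELeft inst) in
  let sq := ECall 3 (ENode n1 n1) in
  let fuel := ECall 2 (ENode (ECall 3 (ENode sq sq)) (ELeft (ERight (EVar 0)))) in
  ELet (ENode (ENode fuel (ENode (ELeft (EVar 0)) inst)) ELeaf) (code 4 h).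

(** If the round yields [None], the loop continues with [D.+1]; squaring the stored tower gives the
    next one. *)
Definition search_body (h : hexpr) : expr :=
  let q := ELeft (ERight (EVar 1)) in
  ELet (round_expr h)
    (EIf (EVar 0) (ELeft (EVar 0))
      (ECall 1 (ENode (ENode ELeaf (ELeft (EVar 1)))
         (ENode (ECall 3 (ENode q q)) (ERight (ERight (EVar 1))))))).

(** The search starts at [D = 0], where the stored tower is [tower 2 = 16]. *)
Definition solver (h : hexpr) : program :=
  [:: ECall 1 (ENode ELeaf (ENode (numeral 16 ELeaf) (EVar 0)));
      search_body h; add_body 2; mul_body 2 3] ++ functions 4 h.

(** The first summand pays for the rounds of the auction, the second for the number of
    candidates. *)
Definition fuel (n D : nat) : nat := n.+1 ^ 4 + tower D.+2.

Lemma tower_large D : (3 * D.+1) ^ D <= tower D.+2.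
Proof.
have H1 : 3 * D.+1 <= 2 ^ D.+2.
  by elim: D => // D IH; rewrite expnS; lia.
(* Only [D * D + 2 * D] is needed; the added 3 makes the induction go through. *)
have H2 : D * D + 2 * D + 3 <= 2 ^ D.+2.
  by elim: D {H1} => // D IH; rewrite expnS; lia.
apply: leq_trans (_ : (2 ^ D.+2) ^ D <= _); first by case: D H1 {H2} => // D H; rewrite leq_exp2r.
by rewrite -expnM leq_exp2l //; lia.
Qed.

Lemma ltn_tower n : n < tower n.
Proof. by apply: ltn_trans (ltn_expl _ _) (ltn_expl _ _). Qed.

(** The quadratic term pays for computing the fuel and the next tower in unary. *)
Definition search_time (h : hexpr) (L : nat) : nat :=
  time_bound h L + 2000 * (L.+1 * L.+1).

Section Solver.
Variables (h : hexpr) (G : sgraph) (P : {set {set G}}) (k : nat).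
Hypothesis partP : partition P [set: G].
Hypothesis hP : forall D L, #|G| <= L -> #|P| <= L -> D <= L -> 3 <= L ->
  @realizes G P k D L unit _ _ _ h (fun _ : unit => result P k D L).

Local Notation p := (solver h).
Local Notation inst := (encode_instance P k).

Definition search_arg D := Node (encode_nat D) (Node (encode_nat (tower D.+2)) inst).

Lemma eval_round D :
  let L := fuel #|G| D in
  exists2 t,
    eval p [:: search_arg D] (round_expr h) (enc (result P k D L)) t
  & t <= time_bound h L + 1000 * (L.+1 * L.+1).
Proof.
set n := #|G|; move=> L.
have badd : body p 2 = add_body 2 by [].
have bmul : body p 3 = mul_body 2 3 by [].
pose g1 := Node Leaf (encode_graph G).
have sg1 : size (spine g1) = n.+1.
  have -> : size (spine g1) = (size (spine (encode_graph G))).+1 by [].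
  by rewrite spine_encode_seq 2!size_map -cardE.
have [t1 E1 le1] := eval_mul badd bmul g1 g1.
rewrite sg1 in E1 le1.
have [t2 E2 le2] := eval_mul badd bmul (encode_nat (n.+1 * n.+1)) (encode_nat (n.+1 * n.+1)).
rewrite !spine_encode_nat_size in E2 le2.
have [t3 E3 le3] := eval_add badd (encode_nat (n.+1 * n.+1 * (n.+1 * n.+1))) (tower D.+2).
have L_ : n.+1 * n.+1 * (n.+1 * n.+1) + tower D.+2 = L.
  by rewrite /L /fuel !expnS expn0; lia.
rewrite !spine_encode_nat_size in E3 le3; rewrite L_ in E3.
have hosts4 : hosts p 4 (functions 4 h) by [].
have [t4 E4 le4] := eval_code (globals P k D L) hosts4 (enc tt) [:: search_arg D].
rewrite cap_globals in le4.
have DL : D <= L.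
  apply: ltnW; apply: leq_trans (leq_addl _ _).
  by apply: leq_trans (ltn_tower D) (leq_tower _); lia.
have nL : n <= L.
  by apply: leq_trans (leq_addr _ _); rewrite !expnS expn0; nia.
have L3 : 3 <= L.
  apply: leq_trans (leq_addl _ _); apply: leq_trans (_ : tower 2 <= _) => //.
  exact: leq_tower.
have PL : #|P| <= L by apply: leq_trans (card_parts partP) nL.
have hE : den (globals P k D L) h (enc tt) = enc (result P k D L) := hP nL PL DL L3 tt.
rewrite hE in E4.
eexists.
  apply: eval_let; last exact: E4.
  apply: eval_node; last by constructor.
  apply: eval_node; last exact: eval_simple.
  apply: eval_call; last exact: E3.
  apply: eval_node; last exact: eval_simple.
  apply: eval_call; last exact: E2.
  by apply: eval_node; apply: eval_call E1; exact: eval_simple.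
rewrite /=.
have : n.+1 * n.+1 * (n.+1 * n.+1) <= L by rewrite -L_ leq_addr.
move: le1 le2 le3 le4; clear.
set a := n.+1; set T := time_bound h L => le1 le2 le3 le4 leL.
have : (a.+1) * a.+1 <= 4 * (a * a) by rewrite /a; nia.
have : a * a <= a * a * (a * a) by rewrite /a; nia.
have : L.+1 <= L.+1 * L.+1 by nia.
set b := a * a in le2 le3 *. 
have : b.+1 * b.+1 <= 4 * (b * b) by rewrite /b /a; nia.
set LL := L.+1 * L.+1; set b2 := b * b in le3 *.
lia.
Qed.

Lemma fuel_bounds D : let L := fuel #|G| D in
  [/\ #|G| ^ 3 < L, D <= L & (3 * D.+1) ^ D <= L].
Proof.
split.
- by apply: leq_trans (leq_addr _ _); rewrite !expnS expn0; nia.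
- apply: ltnW; apply: leq_trans (leq_addl _ _).
  by apply: leq_trans (ltn_tower D) (leq_tower _); lia.
- by apply: leq_trans (leq_addl _ _); apply: tower_large.
Qed.

(** Induction on the number [j] of rounds left until [D] reaches [dc G], where [result_not_none]
    forces an answer. Fuel grows with [D], so every round is charged at the rate of the last
    possible one. *)
Lemma eval_search K e : (forall L, search_time h L <= K * L.+1 ^ e) ->
  forall j D, D + j = dc G ->
  exists b t,
    [/\ eval p [:: search_arg D] (body p 1) (encode_bool b) t,
        b <-> selective_colorable P k
      & t <= j.+1 * (K * (fuel #|G| (dc G)).+1 ^ e)].
Proof.
move=> HK; set B := K * _.
have time_le D : D <= dc G -> search_time h (fuel #|G| D) <= B.
  move=> Dd; apply: leq_trans (HK _) _; rewrite leq_mul2l; apply/orP; right.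
  by case: (e) => // e'; rewrite leq_exp2r // ltnS leq_add2l leq_tower.
have found D j b : D <= dc G -> result P k D (fuel #|G| D) = Some b ->
    exists b t,
      [/\ eval p [:: search_arg D] (body p 1) (encode_bool b) t,
          b <-> selective_colorable P k & t <= j.+1 * B].
  move=> Dd r; have [t E le] := eval_round D; have [nL DL sL] := fuel_bounds D.
  rewrite r in E; exists b; eexists; split; last first; first 1 last.
  - exact: result_correct r.
  - apply: eval_let; first exact: E.
    by apply: eval_if_node; exact: eval_simple.
  move: le (time_le _ Dd); rewrite /search_time /= mulSn; clear.
  by set LL := _.+1 * _; lia.
elim=> [|j IH] D Dj; case r: (result P k D (fuel #|G| D)) => [b|].
- by apply: found r; lia.
- have [_ DL sL] := fuel_bounds D.
  by exfalso; apply: (result_not_none DL sL _ r); lia.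
- by apply: found r; lia.
have Dd : D <= dc G by lia.
have [t E le] := eval_round D; have leB := time_le _ Dd; rewrite r in E.
have [b [t1 [E1 bP le1]]] : exists b t,
    [/\ eval p [:: search_arg D.+1] (body p 1) (encode_bool b) t,
        b <-> selective_colorable P k & t <= j.+1 * B].
  by apply: IH; lia.
have [t2 E2 le2] := @eval_mul p 2 3 erefl erefl (encode_nat (tower D.+2)) (encode_nat (tower D.+2)).
rewrite !spine_encode_nat_size -towerS in E2 le2.
exists b; eexists; split; last first; first 1 last.
- exact: bP.
- apply: eval_let; first exact: E.
  apply: eval_if_leaf; first exact: eval_simple.
  apply: eval_call; last exact: E1.
  apply: eval_node; first exact: eval_simple.
  apply: eval_node; last exact: eval_simple.
  by apply: eval_call E2; exact: eval_simple.
have : (tower D.+2).+1 * (tower D.+2).+1 <= (fuel #|G| D).+1 * (fuel #|G| D).+1.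
  by rewrite leq_mul // ltnS leq_addl.
move: le le1 le2 leB; rewrite /search_time /= mulSn; clear.
by set LL := _.+1 * (fuel _ _).+1; lia.
Qed.

End Solver.

Theorem theorem1 :
  exists (p : program) (g : nat -> nat) (c : nat),
    computable g /\
    forall (G : sgraph) (P : {set {set G}}) (k : nat),
      partition P [set: G] ->
      exists (b : bool) (t : nat),
        [/\ runs p (encode_instance P k) (encode_bool b) t,
            b <-> selective_colorable P k
          & t <= g (dc G) * #|G|.+1 ^ c].
Proof.
have [h hP] := result_realized.
have [K [e HK]] : poly_bounded (search_time h).
  apply: poly_add (poly_time_bound h) (poly_mul (poly_const 2000) _).
  have S : poly_bounded succn by exists 1, 1 => L; lia.
  exact: poly_mul.
(* The fuel is polynomial of degree 4 in the number of vertices and enters with exponent [e]; the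
   shift of the tower absorbs all factors depending on [dc G] only. *)
exists (solver h), (fun n => tower (n + (K + 100 + 6 * e))), (4 * e).
split; first exact: computable_tower.
move=> G P k partP.
have [b [t [E bP le]]] := eval_search partP (hP G P k) HK (add0n (dc G)).
exists b; eexists; split; [|exact: bP|].
  apply: eval_call; last exact: E.
  apply: eval_node; first by constructor.
  apply: eval_node; last by constructor.
  by apply: (@eval_numeral _ _ ELeaf 0 1 16); constructor.
move: (dc G) le => d {E bP} le.
apply: leq_trans (_ : 100 + d.+1 * (K * (fuel #|G| d).+1 ^ e) <= _).
  by move: le; rewrite /=; lia.
set N := #|G|.+1; set Q := tower d.+2.
have Q0 : 0 < Q by rewrite expn_gt0.
have N0 : 0 < N ^ 4 by rewrite expn_gt0.
have leL : (fuel #|G| d).+1 ^ e <= 3 ^ e * Q ^ e * N ^ (4 * e).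
  rewrite expnM -!expnMn; case: (e) => // e'.
  by rewrite leq_exp2r // /fuel -/N -/Q; nia.
apply: leq_trans (_ : (d.+1 * ((K + 100) * (3 ^ e * Q ^ e))) * N ^ (4 * e) <= _).
  have : 0 < 3 ^ e * Q ^ e * N ^ (4 * e) by rewrite !muln_gt0 ![0 < _ ^ e]expn_gt0 Q0 expn_gt0.
  move: leL; set X := 3 ^ e * Q ^ e; set Y := N ^ (4 * e); set Z := _ ^ e.
  move=> leL pos; apply: leq_trans (_ : d.+1 * ((K + 100) * (X * Y)) <= _); last by lia.
  have : K * Z <= K * (X * Y) by rewrite leq_mul2l leL orbT.
  by nia.
rewrite leq_mul2r; apply/orP; right.
have a1 : d.+1 <= 2 ^ 2 ^ d by exact: ltn_tower.
have a2 : K + 100 <= 2 ^ (K + 100) by apply: ltnW; apply: ltn_expl.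
have a3 : 3 ^ e <= 2 ^ (2 * e).
  by rewrite expnM; case: (e) => // e'; rewrite leq_exp2r.
have a4 : Q ^ e = 2 ^ (4 * 2 ^ d * e).
  by rewrite expnM /Q /tower !expnS mulnA.
apply: leq_trans (_ : 2 ^ 2 ^ d * (2 ^ (K + 100) * (2 ^ (2 * e) * 2 ^ (4 * 2 ^ d * e))) <= _).
  by rewrite a4; do ! apply: leq_mul.
(* The exponent on the left is at most [2 ^ d * (1 + (K + 100 + 6 * e))], and the second factor is
   at most [2 ^ (K + 100 + 6 * e)]. *)
rewrite -!expnD leq_exp2l // expnD.
have : 2 ^ d > 0 by rewrite expn_gt0.
have : K + 100 + 6 * e < 2 ^ (K + 100 + 6 * e) by apply: ltn_expl.
set u := 2 ^ d; set v := 2 ^ _; nia.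
Qed.
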